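(* Let $\mathcal A$ be a finite alphabet. Let $U$ be a recursively enumerable set of equations between $\mu$-expressions over $\mathcal A$ such that (i) $U$ extends $\mu\mathsf S+\mathsf{idem}$, i.e. every equation derivable in $\mu\mathsf S+\mathsf{idem}$ belongs to $U$; and (ii) $U$ is sound for the language model $\mathcal L$, i.e. every equation in $U$ is valid in $\mathcal L$. Then $U$ is $\Sigma^0_1$-complete.
   Context: Expressions. Let $\mathcal A$ be the finite alphabet and $\mathcal V$ a countably infinite set of variables disjoint from $\mathcal A$. The $\mu$-expressions are generated by $$e,f,\dots ::= 0 \mid 1 \mid a\in\mathcal A \mid x\in\mathcal V \mid e+f \mid e\cdot f \mid \mu x\, e,$$ where $\mu x$ binds $x$; expressions are identified up to renaming of bound variables, and $e\cdot f$ is written $ef$. If $e(x)$ is an expression (possibly with further free variables), $e(f)$ is the result of capture-avoiding substitution of $f$ for $x$. The theory $\mu\mathsf S$. It is the equational theory of $\mu$-expressions whose axioms are all instances, for arbitrary (possibly open) $\mu$-expressions, of: $e+(f+g)=(e+f)+g$; $e+f=f+e$; $e+0=e$; $e(fg)=(ef)g$; $e1=e$; $1e=e$; $e0=0$; $0e=0$; $e(f+g)=ef+eg$; $(e+f)g=eg+fg$; and the fixed point axiom $\mu x\,e(x)=e(\mu x\,e(x))$. Derivations use reflexivity, symmetry, transitivity and congruence for $+$ and $\cdot$; there is no congruence rule for $\mu$ (from $e(x)=f(x)$ one may not infer $\mu x\,e(x)=\mu x\,f(x)$). $\mu\mathsf S+\mathsf{idem}$ further has the axioms $e+e=e$ for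 all $\mu$-expressions $e$. Language model $\mathcal L$. Expand the syntax by a constant for each language $A\subseteq\mathcal A^*$. To each closed expression $e$ of the expanded syntax a language $\mathcal L(e)\subseteq\mathcal A^*$ is assigned: $\mathcal L(0)=\varnothing$, $\mathcal L(1)=\{\varepsilon\}$, $\mathcal L(a)=\{a\}$, $\mathcal L(A)=A$, $\mathcal L(e+f)=\mathcal L(e)\cup\mathcal L(f)$, $\mathcal L(ef)=\{uv: u\in\mathcal L(e), v\in\mathcal L(f)\}$, $\mathcal L(\mu x\,e(x))=\bigcap\{A\subseteq\mathcal A^*:\mathcal L(e(A))\subseteq A\}$. An equation $e(\vec x)=f(\vec x)$ is valid in $\mathcal L$ if $\mathcal L(e(\vec A))=\mathcal L(f(\vec A))$ for all languages $\vec A$. Theories are identified with the set of equations they prove, and sets of equations with sets of natural numbers via a fixed standard coding. $\Sigma^0_1$-complete means r.e. and such that every r.e. set of natural numbers many-one reduces to it.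
   Formalization: The finite alphabet is required to have at least two letters; for alphabets with zero or one letter the claim fails, since there are decidable sets U (all valid equations, resp. equality of Parikh images) that satisfy (i) and (ii). *)

(* Defs.v *)
From mathcomp Require Import all_boot.
From mathcomp Require Import boolp classical_sets.

Set Implicit Arguments.
Unset Strict Implicit.
Unset Printing Implicit Defensive.

Local Open Scope classical_set_scope.

(* mu-expressions in de Bruijn form, which represents expressions modulo
   renaming of bound variables by exactly one term each.  The variable set is
   nat: under k binders, [Var i] is bound if i < k and otherwise denotes the
   free variable number i - k. *)
Inductive expr (A : finType) : Type :=
| Zero
| One
| Letter (a : A)
| Var (i : nat)
| Add (e f : expr A)
| Mul (e f : expr A)
| Mu (e : expr A).

Arguments Zero {A}.
Arguments One {A}.
Arguments Var {A} i.

Definition scons (T : Type) (x : T) (s : nat -> T) (i : nat) : T :=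
  if i is j.+1 then s j else x.

Definition up_ren (r : nat -> nat) : nat -> nat := scons 0 (fun i => (r i).+1).

Fixpoint rename (A : finType) (r : nat -> nat) (e : expr A) : expr A :=
  match e with
  | Zero => Zero
  | One => One
  | Letter a => Letter a
  | Var i => Var (r i)
  | Add e f => Add (rename r e) (rename r f)
  | Mul e f => Mul (rename r e) (rename r f)
  | Mu e => Mu (rename (up_ren r) e)
  end.

Definition up_subst (A : finType) (s : nat -> expr A) : nat -> expr A :=
  scons (Var 0) (fun i => rename S (s i)).

Fixpoint subst (A : finType) (s : nat -> expr A) (e : expr A) : expr A :=
  match e with
  | Zero => Zero
  | One => One
  | Letter a => Letter a
  | Var i => s i
  | Add e f => Add (subst s e) (subst s f)
  | Mul e f => Mul (subst s e) (subst s f)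
  | Mu e => Mu (subst (up_subst s) e)
  end.

(* e(f), where the distinguished variable x of e(x) is the index 0 of e. *)
Definition inst (A : finType) (e f : expr A) : expr A := subst (scons f Var) e.

Inductive muS_axiom (A : finType) : expr A -> expr A -> Prop :=
| ax_addA e f g : muS_axiom (Add e (Add f g)) (Add (Add e f) g)
| ax_addC e f : muS_axiom (Add e f) (Add f e)
| ax_add0 e : muS_axiom (Add e Zero) e
| ax_mulA e f g : muS_axiom (Mul e (Mul f g)) (Mul (Mul e f) g)
| ax_mul1 e : muS_axiom (Mul e One) e
| ax_1mul e : muS_axiom (Mul One e) e
| ax_mul0 e : muS_axiom (Mul e Zero) Zero
| ax_0mul e : muS_axiom (Mul Zero e) Zero
| ax_mulDr e f g : muS_axiom (Mul e (Add f g)) (Add (Mul e f) (Mul e g))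
| ax_mulDl e f g : muS_axiom (Mul (Add e f) g) (Add (Mul e g) (Mul f g))
| ax_fix e : muS_axiom (Mu e) (inst e (Mu e)).

Inductive muS_idem_axiom (A : finType) : expr A -> expr A -> Prop :=
| ax_muS e f : muS_axiom e f -> muS_idem_axiom e f
| ax_idem e : muS_idem_axiom (Add e e) e.

(* There is deliberately no congruence rule for [Mu]. *)
Inductive derivable (A : finType) (ax : expr A -> expr A -> Prop) :
    expr A -> expr A -> Prop :=
| d_ax e f : ax e f -> derivable ax e f
| d_refl e : derivable ax e e
| d_sym e f : derivable ax e f -> derivable ax f e
| d_trans e f g : derivable ax e f -> derivable ax f g -> derivable ax e g
| d_add e e' f f' : derivable ax e e' -> derivable ax f f' ->
    derivable ax (Add e f) (Add e' f')
| d_mul e e' f f' : derivable ax e e' -> derivable ax f f' ->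
    derivable ax (Mul e f) (Mul e' f').

(* [lang rho e] is the language of the closed expression obtained from e by
   replacing each free variable i by a constant for the language [rho i]. *)
Fixpoint lang (A : finType) (rho : nat -> set (seq A)) (e : expr A) :
    set (seq A) :=
  match e with
  | Zero => set0
  | One => [set [::]]
  | Letter a => [set [:: a]]
  | Var i => rho i
  | Add e f => lang rho e `|` lang rho f
  | Mul e f => [set u ++ v | u in lang rho e & v in lang rho f]
  | Mu e => \bigcap_(X in [set X | lang (scons X rho) e `<=` X]) X
  end.

Definition equation (A : finType) : Type := (expr A * expr A)%type.

Definition valid (A : finType) (p : equation A) : Prop :=
  forall rho : nat -> set (seq A), lang rho p.1 = lang rho p.2.

(* Cantor's pairing bijection. *)
Definition cpair (m n : nat) : nat := ((m + n) * (m + n).+1)./2 + n.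

Fixpoint code (A : finType) (e : expr A) : nat :=
  match e with
  | Zero => cpair 0 0
  | One => cpair 1 0
  | Letter a => cpair 2 (enum_rank a)
  | Var i => cpair 3 i
  | Add e f => cpair 4 (cpair (code e) (code f))
  | Mul e f => cpair 5 (cpair (code e) (code f))
  | Mu e => cpair 6 (code e)
  end.

Definition code_eqn (A : finType) (p : equation A) : nat :=
  cpair (code p.1) (code p.2).

Definition coded (A : finType) (U : set (equation A)) : set nat :=
  @code_eqn A @` U.

(* Kleene's partial recursive functions; [recfun n] are the n-ary ones. *)
Inductive recfun : nat -> Type :=
| RZero : recfun 0
| RSucc : recfun 1
| RProj n (i : 'I_n) : recfun n
| RComp m n (f : recfun m) (g : 'I_m -> recfun n) : recfun n
| RRec n (f : recfun n) (g : recfun n.+2) : recfun n.+1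
| RMin n (f : recfun n.+1) : recfun n.

(* h(0, v) = f(v) and h(k.+1, v) = g(k, h(k, v), v), as a relation. *)
Fixpoint rec_graph (F G : seq nat -> nat -> Prop) (v : seq nat) (k y : nat) :
    Prop :=
  match k with
  | 0 => F v y
  | k'.+1 => exists2 z, rec_graph F G v k' z & G [:: k', z & v] y
  end.

(* [eval f v y]: f is defined at the argument list v, with value y.  For
   f : recfun n this is only meaningful, and only used, when v has size n, so
   the defaults of [head] and [nth] are never reached. *)
Fixpoint eval n (f : recfun n) {struct f} : seq nat -> nat -> Prop :=
  match f with
  | RZero => fun _ y => y = 0
  | RSucc => fun v y => y = (head 0 v).+1
  | RProj n i => fun v y => y = nth 0 v i
  | RComp m n f g => fun v y =>
      exists w : seq nat,
        [/\ size w = m, forall i : 'I_m, eval (g i) v (nth 0 w i) & eval f w y]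
  | RRec n f g => fun v y =>
      rec_graph (eval f) (eval g) (behead v) (head 0 v) y
  | RMin n f => fun v y =>
      eval f (y :: v) 0 /\ forall z, z < y -> exists t, eval f (z :: v) t.+1
  end.

Definition recursively_enumerable (P : set nat) : Prop :=
  exists f : recfun 1, forall n, P n <-> exists y, eval f [:: n] y.

Definition total_recursive (h : nat -> nat) : Prop :=
  exists f : recfun 1, forall n, eval f [:: n] (h n).

Definition many_one_reducible (P Q : set nat) : Prop :=
  exists2 h : nat -> nat, total_recursive h & forall n, P n <-> Q (h n).

Definition Sigma01_complete (Q : set nat) : Prop :=
  recursively_enumerable Q /\
  forall P : set nat, recursively_enumerable P -> many_one_reducible P Q.

(* Main.v *)
Require Import Defs.
From HB Require Import structures.
From Stdlib Require Import Setoid Morphisms.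
From mathcomp Require Import all_boot.
From mathcomp Require Import boolp classical_sets zify.

Set Implicit Arguments.
Unset Strict Implicit.
Unset Printing Implicit Defensive.

Local Open Scope classical_set_scope.

(** The idea.  A recursively enumerable set that separates two effectively
    inseparable sets is Sigma01-complete.  Here the two sets are the equations
    derivable in [muS_idem_axiom] and the equations that fail in the language
    model, and [race_claim] is their inseparability: for partial recursive
    [f1] and [f2] there are fixed expressions [T] and [E] such that, whenever
    [f1] or [f2] halts on [(a, b, c)], either [f1] halts and
    [claim a b c T E = E] is derivable, or [f2] halts and this equation fails.
    Which case occurs is decided by running [f1] and [f2] in parallel.

    Given an r.e. set [P], let [f1] on [(n, x, y)] search for a proof that [n]
    is in [P], and let [f2] search for the code of
    [claim n x y T E = E] in [coded U], where [T] and [E] are read off from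
    their codes [x] and [y].  This code is an arithmetical expression in [n],
    [x] and [y], so [f2] exists before [T] and [E] are known; feeding it
    [x = code T] and [y = code E] makes the equation speak of its own
    membership in [U], and takes the place of the recursion theorem.  If [n] is
    in [P], the race ends: either the equation is derivable, hence in [U], or
    [f2] has found it in [U].  If the equation is in [U], the race ends too: it
    cannot fail in the language model, so [f1] has halted and [n] is in [P].

    For [race_claim], both functions are compiled to while programs on
    registers ([compile_correct]), the programs to one counter machine which
    alternates between them ([pconf_sim]), and the machine to a queue automaton
    which keeps each register as a number of letters in the queue
    ([queue_sim]).  The run of a queue automaton is a single infinite word
    [w0 w1 w2 ...] of pairs (state, letter read), in which every symbol is
    forced by the earlier ones: the state by the previous symbol, the letter by
    what the earlier symbols have written.  The expression [histexpr] denotes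
    the words that have a bad prefix (a wrong state, a wrong letter, or the
    first function having halted) or do not end with the second function
    having halted.  The distance between the symbol that writes a letter and
    the symbol that reads it is a sum of contributions of the symbols before
    the writer, so that wrong letters are recognised by a one-counter grammar
    ([lag]); this is the only place where context-free power is used.

    If the second function wins, the history of the race is a word outside
    [histexpr].  If the first one wins after [N] steps, then every word with
    more than [N] symbols has a bad prefix.  Membership of a word in the
    language of an expression is always derivable ([lang_word_le]), and the
    finitely many words up to that length can be put together by unfolding the
    expression for all words and distributivity ([bar_lee]): one obtains a
    derivation that uses no induction and no congruence under [Mu]. *)

(** * Substitution *)

Section Substitution.
Variable A : finType.
Implicit Types (e f : expr A) (s : nat -> expr A).

Lemma subst_ext s t e : s =1 t -> subst s e = subst t e.
Proof.
elim: e s t => //= [e IHe f IHf|e IHe f IHf|e IHe] s t st.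
- by rewrite (IHe _ _ st) (IHf _ _ st).
- by rewrite (IHe _ _ st) (IHf _ _ st).
by congr Mu; apply: IHe => -[|i] //=; rewrite /up_subst /= st.
Qed.

Lemma subst_Var e : subst Var e = e.
Proof.
elim: e => //= [e -> f ->|e -> f ->|e IHe] //.
by congr Mu; rewrite -[RHS]IHe; apply: subst_ext => -[].
Qed.

Lemma subst_rename s r e : subst s (rename r e) = subst (s \o r) e.
Proof.
elim: e s r => //= [e IHe f IHf|e IHe f IHf|e IHe] s r.
- by rewrite IHe IHf.
- by rewrite IHe IHf.
by congr Mu; rewrite IHe; apply: subst_ext => -[].
Qed.

Lemma rename_ext r t e : r =1 t -> rename r e = rename t e.
Proof.
elim: e r t => //= [i|e IHe f IHf|e IHe f IHf|e IHe] r t rt.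
- by rewrite rt.
- by rewrite (IHe _ _ rt) (IHf _ _ rt).
- by rewrite (IHe _ _ rt) (IHf _ _ rt).
by congr Mu; apply: IHe => -[|i] //=; rewrite /up_ren /= rt.
Qed.

Lemma rename_rename r t e : rename r (rename t e) = rename (r \o t) e.
Proof.
elim: e r t => //= [e IHe f IHf|e IHe f IHf|e IHe] r t.
- by rewrite IHe IHf.
- by rewrite IHe IHf.
by congr Mu; rewrite IHe; apply: rename_ext => -[].
Qed.

Lemma rename_subst r s e : rename r (subst s e) = subst (rename r \o s) e.
Proof.
elim: e r s => //= [e IHe f IHf|e IHe f IHf|e IHe] r s.
- by rewrite IHe IHf.
- by rewrite IHe IHf.
congr Mu; rewrite IHe; apply: subst_ext => -[|i] //=.
by rewrite /up_subst /= !rename_rename.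
Qed.

Lemma subst_subst s t e : subst s (subst t e) = subst (subst s \o t) e.
Proof.
elim: e s t => //= [e IHe f IHf|e IHe f IHf|e IHe] s t.
- by rewrite IHe IHf.
- by rewrite IHe IHf.
congr Mu; rewrite IHe; apply: subst_ext => -[|i] //=.
by rewrite /up_subst /= subst_rename rename_subst; apply: subst_ext.
Qed.

(** Relates the unfolding of [Mu] under a substitution to a single parallel
    substitution, which is the form that an induction on expressions needs. *)
Lemma inst_up_subst s e f : inst (subst (up_subst s) e) f = subst (scons f s) e.
Proof.
rewrite /inst subst_subst; apply: subst_ext => -[|i] //=.
by rewrite /up_subst /= subst_rename -[RHS]subst_Var; apply: subst_ext.
Qed.

End Substitution.

(** * Derivable inequalities *)
Section Derivability.
Variable A : finType.
Implicit Types (e f g : expr A).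

Definition eqv : expr A -> expr A -> Prop := derivable (@muS_idem_axiom A).

Lemma eqv_refl e : eqv e e.
Proof. exact: d_refl. Qed.

#[local] Hint Resolve eqv_refl : core.

#[global] Instance eqv_equivalence : Equivalence eqv.
Proof.
split=> [e|e f|e f g]; [exact: d_refl | exact: d_sym | exact: d_trans].
Qed.

#[global] Instance Add_eqv : Proper (eqv ==> eqv ==> eqv) (@Add A).
Proof. by move=> e e' ee f f' ff; apply: d_add. Qed.

#[global] Instance Mul_eqv : Proper (eqv ==> eqv ==> eqv) (@Mul A).
Proof. by move=> e e' ee f f' ff; apply: d_mul. Qed.

Lemma eqv_muS e f : muS_axiom e f -> eqv e f.
Proof. by move=> ax; apply/d_ax/ax_muS. Qed.

Lemma eqv_addA e f g : eqv (Add e (Add f g)) (Add (Add e f) g).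
Proof. exact/eqv_muS/ax_addA. Qed.
Lemma eqv_addC e f : eqv (Add e f) (Add f e).
Proof. exact/eqv_muS/ax_addC. Qed.
Lemma eqv_add0 e : eqv (Add e Zero) e.
Proof. exact/eqv_muS/ax_add0. Qed.
Lemma eqv_mulA e f g : eqv (Mul e (Mul f g)) (Mul (Mul e f) g).
Proof. exact/eqv_muS/ax_mulA. Qed.
Lemma eqv_mul1 e : eqv (Mul e One) e.
Proof. exact/eqv_muS/ax_mul1. Qed.
Lemma eqv_1mul e : eqv (Mul One e) e.
Proof. exact/eqv_muS/ax_1mul. Qed.
Lemma eqv_mul0 e : eqv (Mul e Zero) Zero.
Proof. exact/eqv_muS/ax_mul0. Qed.
Lemma eqv_0mul e : eqv (Mul Zero e) Zero.
Proof. exact/eqv_muS/ax_0mul. Qed.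
Lemma eqv_mulDr e f g : eqv (Mul e (Add f g)) (Add (Mul e f) (Mul e g)).
Proof. exact/eqv_muS/ax_mulDr. Qed.
Lemma eqv_mulDl e f g : eqv (Mul (Add e f) g) (Add (Mul e g) (Mul f g)).
Proof. exact/eqv_muS/ax_mulDl. Qed.
Lemma eqv_fix e : eqv (Mu e) (inst e (Mu e)).
Proof. exact/eqv_muS/ax_fix. Qed.
Lemma eqv_idem e : eqv (Add e e) e.
Proof. exact/d_ax/ax_idem. Qed.

(** The natural order of an idempotent semiring, provably. *)
Definition lee e f := eqv (Add e f) f.

#[global] Instance lee_eqv : Proper (eqv ==> eqv ==> iff) lee.
Proof.
move=> e e' ee f f' ff; rewrite /lee.
by split=> [|] h; [rewrite -ee -ff | rewrite ee ff].
Qed.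

#[global] Instance lee_preorder : PreOrder lee.
Proof.
split=> [e|e f g]; first exact: eqv_idem.
rewrite /lee => ef fg; transitivity (Add e (Add f g)); first by rewrite fg.
by rewrite eqv_addA ef.
Qed.

Lemma lee_lub e f g : lee e g -> lee f g -> lee (Add e f) g.
Proof. by rewrite /lee => eg fg; rewrite -eqv_addA fg. Qed.

Lemma lee_addl e f : lee e (Add e f).
Proof. by rewrite /lee eqv_addA eqv_idem. Qed.

Lemma lee_addr e f : lee f (Add e f).
Proof. by rewrite eqv_addC; exact: lee_addl. Qed.

Lemma lee0 e : lee Zero e.
Proof. by rewrite /lee eqv_addC eqv_add0. Qed.

Lemma lee_mul e e' f f' : lee e e' -> lee f f' -> lee (Mul e f) (Mul e' f').
Proof.
move=> ee ff; transitivity (Mul e' f).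
  by rewrite /lee -eqv_mulDl ee.
by rewrite /lee -eqv_mulDr ff.
Qed.

Definition word (w : seq A) : expr A := foldr (fun a => Mul (Letter a)) One w.

Lemma word_cat u v : eqv (word (u ++ v)) (Mul (word u) (word v)).
Proof.
elim: u => [|a u IH] /=; first by rewrite eqv_1mul.
by rewrite IH eqv_mulA.
Qed.


(** A word belongs to the language of [Mu e] because it belongs to every
    prefixed point; the words that are provably below [Mu e] form a prefixed
    point, by the fixed point axiom alone. *)
Lemma lang_word_le_subst (rho : nat -> set (seq A)) (s : nat -> expr A) e w :
  (forall i u, rho i u -> lee (word u) (s i)) ->
  lang rho e w -> lee (word w) (subst s e).
Proof.
elim: e rho s w => //= [|a|i|e IHe f IHf|e IHe f IHf|e IHe] rho s w hs.
- by move=> ->; reflexivity.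
- by move=> -> /=; rewrite eqv_mul1; reflexivity.
- exact: hs.
- case=> [/(IHe _ _ _ hs) he|/(IHf _ _ _ hs) hf].
    by transitivity (subst s e) => //; apply: lee_addl.
  by transitivity (subst s f) => //; apply: lee_addr.
- case=> u /(IHe _ _ _ hs) hu [v /(IHf _ _ _ hs) hv <-].
  by rewrite word_cat; apply: lee_mul.
pose X : set (seq A) := [set u | lee (word u) (Mu (subst (up_subst s) e))].
move=> /(_ X); apply=> u /= hu; rewrite /X /= eqv_fix inst_up_subst.
by apply: IHe hu => -[|i] v //=; apply: hs.
Qed.

Lemma lang_word_le e w : lang (fun=> set0) e w -> lee (word w) e.
Proof.
move=> h; rewrite -[e]subst_Var.
by apply: lang_word_le_subst h => i u [].
Qed.

End Derivability.

#[global] Hint Resolve eqv_refl : core.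

(** * Finite sums, all words, and bars *)
Section Sums.
Variable A : finType.

Definition lsum (X : Type) (l : seq X) (F : X -> expr A) : expr A :=
  foldr (fun x => Add (F x)) Zero l.

Lemma subst_lsum s (X : Type) (l : seq X) (F : X -> expr A) :
  subst s (lsum l F) = lsum l (subst s \o F).
Proof. by elim: l => //= x l ->. Qed.

Lemma lang_lsum rho (X : eqType) (l : seq X) (F : X -> expr A) w :
  lang rho (lsum l F) w <-> exists2 x, x \in l & lang rho (F x) w.
Proof.
elim: l => [|x l [IH1 IH2]] /=; first by split=> // -[].
split=> [[h|/IH1[y yl h]]|[y]]; [exists x | exists y|] => //.
- by rewrite inE eqxx.
- by rewrite inE yl orbT.
by rewrite inE => /orP[/eqP->|yl h]; [left | right; apply: IH2; exists y].
Qed.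

Definition star (P : pred A) : expr A :=
  Mu (Add One (Mul (lsum (enum P) (@Letter A)) (Var 0))).

Definition anyw := star xpredT.

Lemma star_unfold P :
  eqv (star P) (Add One (Mul (lsum (enum P) (@Letter A)) (star P))).
Proof. by rewrite {1}/star eqv_fix /inst /= subst_lsum. Qed.

Lemma lsum_lee e (X : eqType) (l : seq X) F f g :
  {in l, forall x, lee (Mul e (Mul (F x) f)) g} ->
  lee (Mul e (Mul (lsum l F) f)) g.
Proof.
elim: l => [|x l IH] /= h; first by rewrite eqv_0mul eqv_mul0; apply: lee0.
rewrite eqv_mulDl eqv_mulDr; apply: lee_lub; first by apply: h; rewrite inE eqxx.
by apply: IH => y yl; apply: h; rewrite inE yl orbT.
Qed.

(** A word is either [v] or a proper extension of it, and the latter begins with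
    [rcons v a] for some letter [a]. *)
Lemma word_any_le v e :
  lee (word v) e -> (forall a, lee (Mul (word (rcons v a)) anyw) e) ->
  lee (Mul (word v) anyw) e.
Proof.
move=> h1 h2; rewrite {1}/anyw star_unfold -/anyw eqv_mulDr eqv_mul1.
apply: lee_lub => //; apply: lsum_lee => a _.
by move: (h2 a); rewrite -cats1 word_cat /= eqv_mul1 -eqv_mulA.
Qed.

Lemma word_mul_any u : lee (Mul (word u) anyw) anyw.
Proof.
elim: u => [|a u IH] /=; first by rewrite eqv_1mul; reflexivity.
rewrite -eqv_mulA {2}/anyw star_unfold -/anyw.
transitivity (Mul (lsum (enum xpredT) (@Letter A)) anyw); last exact: lee_addr.
apply: lee_mul IH.
have: a \in enum (xpredT : pred A) by rewrite mem_enum.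
elim: (enum _) => //= b l IH; rewrite inE => /orP[/eqP<-|/IH {}IH].
  exact: lee_addl.
by transitivity (lsum l (@Letter A)) => //; apply: lee_addr.
Qed.

(** If the words of length [N] after [v] all have a prefix in [e1], and the
    shorter ones are in the language on the right, then the finite tree of these
    words is itself a derivation: its leaves are settled by [lang_word_le] and
    its inner nodes by [word_any_le]. *)
Lemma bar_lee e1 e2 v N :
  (forall u, size u < N -> lang (fun=> set0) (Add (Mul e1 anyw) e2) (v ++ u)) ->
  (forall u, size u = N -> exists x y, v ++ u = x ++ y /\ lang (fun=> set0) e1 x) ->
  lee (Mul (word v) anyw) (Add (Mul e1 anyw) e2).
Proof.
elim: N v => [|N IH] v short long.
  have [x [y [vE /lang_word_le xe1]]] := long [::] erefl.
  rewrite cats0 in vE; rewrite vE word_cat -eqv_mulA.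
  transitivity (Mul e1 anyw); last exact: lee_addl.
  by apply: lee_mul xe1 _; apply: word_mul_any.
apply: word_any_le => [|a].
  by apply: lang_word_le; have := short [::] isT; rewrite cats0.
apply: IH => u hu; rewrite cat_rcons; [apply: short | apply: long] => //=.
by rewrite hu.
Qed.

Lemma lang_Add rho (e f : expr A) w :
  lang rho (Add e f) w <-> lang rho e w \/ lang rho f w.
Proof. by []. Qed.

Lemma lang_Mul rho (e f : expr A) w :
  lang rho (Mul e f) w <->
  exists u v, [/\ lang rho e u, lang rho f v & w = u ++ v].
Proof.
split=> [[u eu [v fv <-]]|[u [v [eu fv ->]]]]; first by exists u, v.
by exists u => //; exists v.
Qed.

Lemma lang_mono (rho rho' : nat -> set (seq A)) e :
  (forall i, rho i `<=` rho' i) -> lang rho e `<=` lang rho' e.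
Proof.
elim: e rho rho' => [||a|i|e IHe f IHf|e IHe f IHf|e IHe] rho rho' h //=.
- by move=> w [/(IHe _ _ h)|/(IHf _ _ h)]; [left|right].
- move=> w [u /(IHe _ _ h) hu [v /(IHf _ _ h) hv <-]].
  by exists u => //; exists v.
move=> w hw X /= hX; apply: hw => u /= hu; apply: hX.
by apply: IHe hu => -[|i] //=; apply: h.
Qed.

Lemma lang_Mu_ind rho (e : expr A) X :
  lang (scons X rho) e `<=` X -> lang rho (Mu e) `<=` X.
Proof. by move=> eX w; apply. Qed.

(** The least prefixed point is a prefixed point, because [lang] is monotone. *)
Lemma lang_Mu_fold rho (e : expr A) :
  lang (scons (lang rho (Mu e)) rho) e `<=` lang rho (Mu e).
Proof.
move=> w hw X /= hX; apply: (hX); apply: lang_mono hw => -[|i] u //=.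
by move/(_ X hX).
Qed.

Lemma lang_letters rho (P : pred A) w :
  lang rho (lsum (enum P) (@Letter A)) w <-> exists2 a, P a & w = [:: a].
Proof.
rewrite lang_lsum; split=> -[a]; rewrite ?mem_enum => Pa /= ->; exists a => //.
by rewrite mem_enum.
Qed.

Lemma lang_star rho (P : pred A) w : lang rho (star P) w <-> all P w.
Proof.
split.
  apply: (@lang_Mu_ind rho _ [set u | all P u]) => {w} u /lang_Add[->//|].
  by case/lang_Mul=> _ [v [/lang_letters[a Pa ->] /= vP ->]] /=; rewrite Pa.
elim: w => [|a w IH] wP; apply: lang_Mu_fold; apply/lang_Add.
  by left.
case/andP: wP => Pa /IH{}IH; right; apply/lang_Mul; exists [:: a], w.
by split=> //; apply/lang_letters; exists a.
Qed.

Lemma lang_any rho w : lang rho anyw w.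
Proof. by apply/lang_star/allP. Qed.

Definition npow (P : pred A) k : expr A :=
  iter k (Mul (lsum (enum P) (@Letter A))) One.

Lemma lang_npow rho (P : pred A) k w :
  lang rho (npow P k) w <-> size w = k /\ all P w.
Proof.
elim: k w => [|k IH] w.
  by split=> [->//|[/size0nil->]].
rewrite /npow iterS lang_Mul; split.
  by case=> _ [v [/lang_letters[a Pa ->] /IH[<- vP] ->]] /=; rewrite Pa.
case: w => [[]//|a w [[sw] /= /andP[Pa wP]]]; exists [:: a], w.
by split=> //; [apply/lang_letters; exists a | apply/IH].
Qed.

End Sums.

(** * Replacing letters by closed expressions *)
Section Hom.
Variables (G A : finType) (c : G -> expr A).

Fixpoint hom (e : expr G) : expr A :=
  match e with
  | Zero => Zero
  | One => One
  | Letter a => c a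
  | Var i => Var i
  | Add e f => Add (hom e) (hom f)
  | Mul e f => Mul (hom e) (hom f)
  | Mu e => Mu (hom e)
  end.

Hypothesis c_closed : forall s g, subst s (c g) = c g.

Lemma c_rename r g : rename r (c g) = c g.
Proof.
rewrite -[rename r _]subst_Var subst_rename c_closed //.
Qed.

Lemma hom_rename r e : hom (rename r e) = rename r (hom e).
Proof.
elim: e r => //= [a|e IHe f IHf|e IHe f IHf|e IHe] r.
- by rewrite c_rename.
- by rewrite IHe IHf.
- by rewrite IHe IHf.
by rewrite IHe.
Qed.

Lemma hom_subst s e : hom (subst s e) = subst (hom \o s) (hom e).
Proof.
elim: e s => //= [e IHe f IHf|e IHe f IHf|e IHe] s.
- by rewrite IHe IHf.
- by rewrite IHe IHf.
rewrite IHe; congr Mu; apply: subst_ext => -[|i] //=.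
by rewrite /up_subst /= hom_rename.
Qed.

(** The letters are constants of the theory: every axiom schema is stable under
    replacing them by closed expressions. *)
Lemma hom_eqv e f : eqv e f -> eqv (hom e) (hom f).
Proof.
elim=> {e f} [e f|e|e f _ IH|e f g _ IH1 _ IH2|e e' f f' _ IH1 _ IH2|
              e e' f f' _ IH1 _ IH2] /=.
- case=> [{}e {}f|{}e]; last exact: eqv_idem.
  case: e f / => [e f g|e f|e|e f g|e|e|e|e|e f g|e f g|e]; 
    try by apply/eqv_muS; constructor.
  rewrite /inst hom_subst /= {1}eqv_fix /inst.
  by rewrite (@subst_ext _ (scons _ _) (hom \o scons (Mu e) Var)) // => -[].
- reflexivity.
- by rewrite IH.
- by rewrite IH1.
- by rewrite IH1 IH2.
by rewrite IH1 IH2.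
Qed.

Variable code : G -> seq A.
Hypothesis lang_c : forall rho g, lang rho (c g) = [set code g].

Definition enc (w : seq G) : seq A := flatten (map code w).

(** For [Mu], a prefixed point [X] of the translated expression yields the
    prefixed point of the words with encoding in [X]; conversely the image of a
    least prefixed point is a prefixed point. *)
Lemma lang_hom rho e :
  lang (fun i => enc @` rho i) (hom e) = enc @` lang rho e.
Proof.
elim: e rho => [||a|i|e IHe f IHf|e IHe f IHf|e IHe] rho.
- by rewrite /= image_set0.
- by rewrite /= image_set1.
- by rewrite [hom _]/= lang_c /= image_set1 /enc /= cats0.
- by [].
- by rewrite /= IHe IHf image_setU.
- apply/seteqP; split=> [w|x [w]].
    rewrite [hom _]/= lang_Mul !IHe !IHf => -[_ [_ [[u hu <-] [v hv <-] ->]]].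
    exists (u ++ v); first by apply/lang_Mul; exists u, v.
    by rewrite /enc map_cat flatten_cat.
  case/lang_Mul=> u [v [hu hv ->]] <-; apply/lang_Mul.
  exists (enc u), (enc v); rewrite !IHe !IHf; split; [by exists u|by exists v|].
  by rewrite /enc map_cat flatten_cat.
have sconsE X : lang (scons (enc @` X) (fun i => enc @` rho i)) (hom e) =
                enc @` lang (scons X rho) e.
  rewrite -IHe; congr lang; apply/funext => -[|i] //.
apply/seteqP; split.
  apply: lang_Mu_ind; rewrite sconsE => _ [u hu <-]; exists u => //.
  exact: lang_Mu_fold hu.
move=> _ [u hu <-] X /= hX.
apply: (lang_Mu_ind (X := [set v | X (enc v)]) _ hu) => v hv /=; apply: hX.
apply: (@lang_mono _ (scons (enc @` [set v | X (enc v)]) (fun i => enc @` rho i))).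
  by move=> [|i] //= _ [z hz <-].
by rewrite sconsE; exists v.
Qed.

End Hom.

(** * The expression of the wrong histories of a queue automaton *)
Section History.
Variables (I S B : finType) (b0 : B) (s0 : S).
Variables (nxt : S * B -> S) (acc rej : pred S).

(** A history starts with the input symbols [inl (Some i)] and the end marker
    [inl None] of the input; its further symbols [inr (s, b)] record that the
    automaton in state [s] reads the letter [b] from its queue.  The symbol [g]
    appends [out g] to the queue, and the input symbols are there to fill the
    queue before the automaton starts. *)
Definition sym : finType := (option I + S * B)%type.

Variable out : sym -> seq B.

Definition isstep (g : sym) : bool := if g is inr _ then true else false.
Definition isinput (g : sym) : bool := if g is inl (Some _) then true else false.
Hypothesis out_pos : forall g, ~~ isinput g -> 0 < size (out g).

(** The contribution of a symbol to the lag between writing and reading.  Each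
    letter written delays the reading of what comes later by one step, and each
    step symbol makes up for one step.  So does the end marker of the input:
    it cancels the step that a later writer itself takes.  An input symbol makes
    up for nothing, since nothing is read before the input ends. *)
Definition weight (g : sym) : nat :=
  if isinput g then size (out g) else (size (out g)).-1.

(** The local condition on neighbouring symbols.  It also forbids input symbols
    after the end marker; a symbol after an input symbol is never bad, because
    the words of interest begin with a given input. *)
Definition bad_next (g c : sym) : bool :=
  match g, c with
  | inl (Some _), _ => false
  | inl None, inr (s, _) => s != s0
  | inr d, inr (s, _) => s != nxt d
  | _, _ => true
  end.

Definition bad_tape (b : B) (c : sym) : bool :=
  if c is inr (_, b') then b' != b else false.

Definition state_sat (P : pred S) (g : sym) : bool :=
  if g is inr (s, _) then P s else false.

(** The prefixes after which the next symbol has to read [b], as far as one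
    writer [g] of [b] is concerned.  If [u] is the word before [g] and [b] is
    the [j]-th letter that [g] writes, then between [g] and its reader there are
    exactly [weights u + j] step symbols, preceded by what is left of the input
    if [g] is an input symbol.  The recursion counts [weights u]. *)
Definition lag (b : B) : expr sym :=
  Mu (Add
    (lsum (enum sym) (fun g => Mul (Letter g) (Mul (Var 0) (npow isstep (weight g)))))
    (lsum (enum sym) (fun g => Mul (Letter g) (Mul (star (predC isstep))
       (lsum [seq j <- iota 0 (size (out g)) | nth b0 (out g) j == b]
          (npow isstep)))))).

Definition mismatch : expr sym :=
  lsum (enum B) (fun b => Mul (lag b) (lsum (enum (bad_tape b)) (@Letter sym))).

Definition bad_pair : expr sym :=
  Mul (anyw sym) (lsum (enum [pred gc : sym * sym | bad_next gc.1 gc.2])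
     (fun gc => Mul (Letter gc.1) (Letter gc.2))).

Definition ends (P : pred sym) : expr sym :=
  Mul (anyw sym) (lsum (enum P) (@Letter sym)).

Definition bad_prefix : expr sym := Add mismatch (Add bad_pair (ends (state_sat acc))).

Definition histexpr : expr sym :=
  Add (Mul bad_prefix (anyw sym)) (ends (predC (state_sat rej))).

Definition weights (u : seq sym) : nat := sumn (map weight u).

Definition outs (u : seq sym) : seq B := flatten (map out u).

Lemma outs_cat u v : outs (u ++ v) = outs u ++ outs v.
Proof. by rewrite /outs map_cat flatten_cat. Qed.

(** The identity behind [weight]: a count of letters written is a count of lag
    plus a count of symbols that make up for one step. *)
Lemma weights_outs u : weights u + count (predC isinput) u = size (outs u).
Proof.
elim: u => //= g u IH; rewrite /weights /= /outs /= size_cat -/(outs u) -IH.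
rewrite /weight; case: ifP => hg /=; first by rewrite -/(weights u); lia.
by have := out_pos (negbT hg); rewrite -/(weights u); lia.
Qed.

Definition lag_spec (b : B) (w : seq sym) : Prop :=
  exists u g z y j, [/\ w = u ++ g :: z ++ y, all (predC isstep) z,
    all isstep y, size y = weights u + j &
    (j < size (out g)) && (nth b0 (out g) j == b)].

(** The symbols counted for the first symbol of [u] are the last ones of [y], so
    both directions peel off [u] from the left and [y] from the right. *)
Lemma lang_lag rho b w : lang rho (lag b) w <-> lag_spec b w.
Proof.
split.
  apply: (@lang_Mu_ind _ rho _ (lag_spec b)) => {w} w /lang_Add[].
    case/lang_lsum=> g _ /lang_Mul[_ [_ [-> /lang_Mul[x [y [hx hy ->]]] ->]]].
    case: hx => u [g' [z [y' [j [-> zP y'P sy' jg]]]]].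
    have /lang_npow[sy yP] := hy.
    exists (g :: u), g', z, (y' ++ y), j; split=> //.
    - by rewrite /= -!catA /= -catA.
    - by rewrite all_cat y'P.
    by rewrite size_cat sy' sy /weights /=; lia.
  case/lang_lsum=> g _ /lang_Mul[_ [_ [-> /lang_Mul[z [y [hz hy ->]]] ->]]].
  have /lang_star zP := hz.
  case/lang_lsum: hy => j; rewrite mem_filter mem_iota leq0n add0n.
  case/andP=> jb /andP[_ jg] /lang_npow[sy yP].
  by exists [::], g, z, y, j; split=> //; rewrite jg jb.
case=> u [g [z [y [j [-> zP yP sy /andP[jg jb]]]]]].
elim: u y yP sy => [|g' u IH] y yP sy; apply: lang_Mu_fold; apply/lang_Add.
  right; apply/lang_lsum; exists g; first by rewrite mem_enum.
  apply/lang_Mul; exists [:: g], (z ++ y); split=> //.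
  apply/lang_Mul; exists z, y; split=> //; first exact/lang_star.
  apply/lang_lsum; exists j; last exact/lang_npow.
  by rewrite mem_filter mem_iota jb leq0n add0n jg.
left; apply/lang_lsum; exists g'; first by rewrite mem_enum.
apply/lang_Mul; exists [:: g'], (u ++ g :: z ++ y); split=> //.
have k_le : weights u + j <= size y by rewrite sy /weights /=; lia.
apply/lang_Mul; exists (u ++ g :: z ++ take (weights u + j) y), (drop (weights u + j) y).
split; last by rewrite -catA /= -catA cat_take_drop.
  apply: IH; last by rewrite size_takel.
  by apply/allP => x /mem_take; apply: (allP yP).
apply/lang_npow; split; first by rewrite size_drop sy /weights /=; lia.
by apply/allP => x /mem_drop; apply: (allP yP).
Qed.

Lemma lang_mismatch rho w : lang rho mismatch w <->
  exists b x c, [/\ w = rcons x c, lag_spec b x & bad_tape b c].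
Proof.
rewrite lang_lsum; split.
  case=> b _ /lang_Mul[x [_ [/lang_lag hx /lang_letters[c cP ->] ->]]].
  by exists b, x, c; rewrite cats1.
case=> b [x [c [-> hx cP]]]; exists b; first by rewrite mem_enum.
apply/lang_Mul; exists x, [:: c]; rewrite cats1; split=> //.
  exact/lang_lag.
by apply/lang_letters; exists c.
Qed.

Lemma lang_ends rho P w : lang rho (ends P) w <-> exists x c, w = rcons x c /\ P c.
Proof.
rewrite lang_Mul; split.
  by case=> x [_ [_ /lang_letters[c cP ->] ->]]; exists x, c; rewrite cats1.
case=> x [c [-> cP]]; exists x, [:: c]; rewrite cats1; split=> //.
  exact: lang_any.
by apply/lang_letters; exists c.
Qed.

Lemma lang_bad_pair rho w : lang rho bad_pair w <->
  exists x g c, w = rcons (rcons x g) c /\ bad_next g c.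
Proof.
rewrite lang_Mul; split.
  case=> x [t [_ /lang_lsum[[g c]]]]; rewrite mem_enum => gc.
  case/lang_Mul=> _ [_ [-> -> ->]] ->; exists x, g, c; split=> //.
  by rewrite -!cats1 -catA.
case=> x [g [c [-> gc]]]; exists x, [:: g; c]; split.
- exact: lang_any.
- apply/lang_lsum; exists (g, c); first by rewrite mem_enum.
  by apply/lang_Mul; exists [:: g], [:: c].
by rewrite -!cats1 -catA.
Qed.

Lemma outs_split w k : k < size (outs w) -> exists u g v j,
  [/\ w = u ++ g :: v, j < size (out g), k = size (outs u) + j &
      nth b0 (outs w) k = nth b0 (out g) j].
Proof.
elim: w k => //= g w IH k; rewrite /outs /= size_cat -/(outs w) nth_cat.
move=> hk; case: ltnP => kg; first by exists [::], g, w, k; split.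
have {}hk : k - size (out g) < size (outs w) by lia.
have [u [g' [v [j [-> jg kE hnth]]]]] := IH _ hk.
exists (g :: u), g', v, j; split=> //.
by rewrite /= size_cat -/(outs u) -addnA -kE subnKC.
Qed.

Lemma nth_outs u g v j : j < size (out g) ->
  nth b0 (outs (u ++ g :: v)) (size (outs u) + j) = nth b0 (out g) j.
Proof.
move=> jg; rewrite outs_cat nth_cat ltnNge leq_addr /= addKn.
by rewrite /outs /= nth_cat jg.
Qed.

(* the run *)
Variable v : seq I.

(** The forced beginning of a history; its outputs are the initial queue. *)
Definition input : seq sym := rcons [seq inl (Some i) | i <- v] (inl None).

Definition queue_step (c : S * seq B) : S * seq B :=
  let g := (c.1, head b0 c.2) in (nxt g, behead c.2 ++ out (inr g)).

Definition run_conf k : S * seq B := iter k queue_step (s0, outs input).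

Lemma run_confS k : run_conf k.+1 = queue_step (run_conf k).
Proof. by []. Qed.

Definition hist_sym k : sym := inr ((run_conf k).1, head b0 (run_conf k).2).

Definition hist N : seq sym := mkseq hist_sym N.

Lemma histS N : hist N.+1 = rcons (hist N) (hist_sym N).
Proof. by rewrite /hist /mkseq -addn1 iotaD map_cat cats1. Qed.

Lemma size_hist N : size (hist N) = N.
Proof. exact: size_mkseq. Qed.

Lemma hist_isstep N : all isstep (hist N).
Proof. by rewrite all_map; apply/allP. Qed.

Definition tape (c : sym) : B := if c is inr (_, b) then b else b0.

(** The queue holds the letters written and not yet read.  It is never empty,
    since a step removes one letter and writes at least one; hence the default
    [b0] is never read. *)
Lemma conf_queue N :
  outs (input ++ hist N) = map tape (hist N) ++ (run_conf N).2 /\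
  0 < size (run_conf N).2.
Proof.
elim: N => [|N [IH1 IH2]].
  rewrite cats0 /=; split=> //.
  rewrite /input -cats1 outs_cat size_cat addn_gt0 orbC.
  by rewrite /outs /= cats0 out_pos.
have pos : 0 < size (out (hist_sym N)) by apply: out_pos.
rewrite histS -cats1 catA outs_cat IH1 [run_conf N.+1]/= /queue_step.
move: pos; rewrite /hist_sym /=; case: (run_conf N) IH2 => s [//|b q] _ /= pos.
rewrite size_cat addn_gt0 pos orbT map_cat /= -!catA /=; split=> //.
by rewrite /outs /= cats0.
Qed.

Lemma head_queue N : head b0 (run_conf N).2 = nth b0 (outs (input ++ hist N)) N.
Proof.
by rewrite (conf_queue N).1 nth_cat size_map size_hist ltnn subnn nth0.
Qed.

Lemma last_state N : exists x g, input ++ hist N = rcons x g /\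
  forall c, bad_next g c = if c is inr (s, _) then s != (run_conf N).1 else true.
Proof.
case: N => [|N].
  by exists [seq inl (Some i) | i <- v], (inl None); rewrite cats0.
by exists (input ++ hist N), (hist_sym N); rewrite histS rcons_cat.
Qed.

(** A step symbol has the end marker before it, an input symbol or the end
    marker itself has not. *)
Lemma split_isstep h u g w : all isstep h -> input ++ h = u ++ g :: w ->
  count (predC isinput) u = count isstep u + isstep g.
Proof.
rewrite /input; move=> hP; elim: v u => [|i v' IH] [|x u] //=.
- by case=> <-.
- case=> <- hE /=; move: hP; rewrite hE all_cat /= => /andP[uP /andP[-> _]].
  rewrite addnC; congr (_ + _).
  elim: u uP {hE} => //= y u IHu /andP[yP uP]; rewrite IHu //.
  by case: y yP => // [].
- by case=> <-.
by case=> <- /IH ->.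
Qed.

(** For the letter read at step [N], written as the [j]-th letter of [g], one has
    [N = size (outs u) + j]; so this says that [weights u + j] step symbols lie
    between writer and reader, as [lag] requires. *)
Lemma split_count N u g w : input ++ hist N = u ++ g :: w ->
  count isstep w + size (outs u) = weights u + N.
Proof.
move=> E; have := split_isstep (hist_isstep N) E; rewrite -weights_outs => ->.
have : count isstep (input ++ hist N) = N.
  rewrite count_cat (_ : count isstep input = 0) ?add0n.
    by move: (hist_isstep N); rewrite all_count size_hist => /eqP.
  rewrite /input -cats1 count_cat /= addn0 count_map.
  by rewrite (@eq_count _ _ pred0) ?count_pred0.
by rewrite E count_cat /=; lia.
Qed.

Lemma drop_sorted (x y w : seq sym) n : all (predC isstep) x -> all isstep y ->
  w = drop n (x ++ y) ->
  exists z t, [/\ w = z ++ t, all (predC isstep) z & all isstep t].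
Proof.
move=> xP yP ->; rewrite drop_cat; case: ltnP => _.
  exists (drop n x), y; split=> //.
  by apply/allP => a /mem_drop; apply: (allP xP).
exists [::], (drop (n - size x) y); split=> //.
by apply/allP => a /mem_drop; apply: (allP yP).
Qed.

Lemma input_init : all (predC isstep) input.
Proof. by rewrite /input all_rcons all_map /=; apply/allP. Qed.

Lemma count_isstep z y : all (predC isstep) z -> all isstep y ->
  count isstep (z ++ y) = size y.
Proof.
move=> zP; rewrite all_count count_cat => /eqP ->.
suff -> : count isstep z = 0 by [].
by apply/eqP; rewrite -leqn0 leqNgt -has_count -all_predC.
Qed.

(** A symbol other than the forced one has the wrong state or the wrong letter;
    in the latter case the writer of the right letter is a witness for [lag]. *)
Lemma deviation_bad rho N c : c != hist_sym N ->
  lang rho bad_prefix (rcons (input ++ hist N) c).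
Proof.
move=> cN; have [x [g [E gP]]] := last_state N.
have [gc|] := boolP (bad_next g c).
  apply/lang_Add; right; apply/lang_Add; left.
  by apply/lang_bad_pair; exists x, g, c; rewrite E.
rewrite gP; case: c cN => [//|[s b]] cN /negPn/eqP sE.
have bE : b != head b0 (run_conf N).2.
  by apply: contraNneq cN => ->; rewrite sE.
apply/lang_Add; left; apply/lang_mismatch.
exists (head b0 (run_conf N).2), (input ++ hist N), (inr (s, b)); split=> //.
have [qE qpos] := conf_queue N.
have : N < size (outs (input ++ hist N)).
  by rewrite qE size_cat size_map size_hist; lia.
case/outs_split=> u [g' [w [j [wE jg NE hj]]]].
have [|z [t [wE' zP tP]]] :=
  @drop_sorted input (hist N) w (size u).+1 input_init (hist_isstep N).
  by rewrite wE -cat_rcons drop_size_cat // size_rcons.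
exists u, g', z, t, j; rewrite wE wE'; split=> //.
  have := split_count wE; rewrite {}wE' count_isstep // NE; lia.
by rewrite jg head_queue hj /=.
Qed.

Lemma not_hist u : u != hist (size u) ->
  exists k c y, u = hist k ++ c :: y /\ c != hist_sym k.
Proof.
elim/last_ind: u => [//|u c IH]; rewrite size_rcons histS.
have [uE|/IH[k [c' [y [-> hc]]]] _] := eqVneq u (hist (size u)).
  rewrite -uE => hc; exists (size u), c, [::]; rewrite -uE cats1; split=> //.
  by apply: contraNneq hc => ->.
by exists k, c', (rcons y c); rewrite rcons_cat.
Qed.

(** A word after the input either follows the run, or has a bad prefix from its
    first deviation on.  If it follows the run for more than [N] steps, it has
    passed an accepting state; if for fewer, it does not end in a rejecting
    one. *)
Theorem acc_lee N : acc (run_conf N).1 ->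
  (forall k, k <= N -> ~~ rej (run_conf k).1) ->
  lee (Mul (word input) (anyw sym)) histexpr.
Proof.
move=> accN norej.
have dev u : u != hist (size u) -> exists x y, input ++ u = x ++ y /\
    lang (fun=> set0) bad_prefix x.
  case/not_hist=> k [c [y [-> hc]]]; exists (rcons (input ++ hist k) c), y.
  by rewrite cat_rcons catA; split=> //; apply: deviation_bad.
(* The accepting state is seen by the symbol number N, hence after N.+1
   symbols. *)
apply: (@bar_lee _ _ _ _ N.+1) => u hu; last first.
  have [uE|/dev//] := eqVneq u (hist (size u)).
  exists (input ++ u), [::]; rewrite cats0; split=> //.
  apply/lang_Add; right; apply/lang_Add; right; apply/lang_ends.
  by exists (input ++ hist N), (hist_sym N); rewrite uE hu histS rcons_cat.
apply/lang_Add; have [uE|/dev[x [y [-> hx]]]] := eqVneq u (hist (size u)).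
  right; apply/lang_ends; rewrite uE; move: (size u) hu => [|k] hk.
    by exists [seq inl (Some i) | i <- v], (inl None); rewrite cats0.
  exists (input ++ hist k), (hist_sym k); rewrite histS rcons_cat; split=> //=.
  by apply: norej; lia.
left; apply/lang_Mul; exists x, y; split=> //; exact: lang_any.
Qed.

(** The converse of [deviation_bad]: along the run, whatever [lag] predicts is
    what is read, because both are determined by [split_count]. *)
Lemma rej_notin rho N : rej (run_conf N).1 ->
  (forall k, k <= N -> ~~ acc (run_conf k).1) ->
  ~ lang rho histexpr (input ++ hist N.+1).
Proof.
move=> rejN noacc /lang_Add[]; last first.
  case/lang_ends=> x [c []]; rewrite histS -rcons_cat => /rcons_inj[_ <-].
  by rewrite /= rejN.
case/lang_Mul=> x [y [hx _ E]].
(* A prefix that ends with a step symbol is the input with a part of the run. *)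
have pref d x' : isstep d -> x = rcons x' d ->
    exists2 k, k <= N & x' = input ++ hist k /\ d = hist_sym k.
  move=> dn xE; have sx : size x <= size (input ++ hist N.+1).
    by rewrite E size_cat leq_addr.
  have xT : x = take (size x) (input ++ hist N.+1) by rewrite E take_size_cat.
  move: xT; rewrite take_cat; case: ltnP => sx'.
    move=> xT; have : d \in take (size x) input by rewrite -xT xE mem_rcons inE eqxx.
    by move/mem_take/(allP input_init); rewrite /= dn.
  move: sx; rewrite size_cat size_hist xE size_rcons => sx.
  have sz : size x = (size x').+1 by rewrite xE size_rcons.
  have [sz0|nz] := eqVneq (size x') ((size input).-1).
    have -> : (size x').+1 - size input = 0.
      by rewrite sz0 /input size_rcons subnn.
    rewrite take0 cats0 => hE; have : d \in input by rewrite -hE mem_rcons inE eqxx.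
    by move/(allP input_init); rewrite /= dn.
  have [k kE] : exists k, (size x').+1 - size input = k.+1.
    by exists ((size x').+1 - size input).-1; lia.
  rewrite kE => hE; exists k; first by lia.
  move: hE; rewrite {1}/hist /mkseq -map_take take_iota (minn_idPl _); last by lia.
  by rewrite -/(mkseq _ _) -/(hist _) histS -rcons_cat => /rcons_inj[-> ->].
case/lang_Add: hx => [/lang_mismatch[b [x' [c [xE hx' hc]]]]|/lang_Add[]].
- have cn : isstep c by case: c hc {xE}.
  have [k _ [x'E cE]] := pref _ _ cn xE.
  case: hx' => u [g [z [t [j [x'E' zP tP st /andP[jg /eqP jb]]]]]].
  move: hc; rewrite cE /hist_sym /bad_tape head_queue.
  have := split_count (etrans (esym x'E) x'E'); rewrite count_isstep // st => kE.
  have {kE} kE : k = size (outs u) + j by lia.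
  by rewrite -x'E x'E' kE nth_outs // jb eqxx.
- case/lang_bad_pair=> x' [g [c [xE gc]]].
  have [cn|cn] := boolP (isstep c).
    have [k _ [x'E cE]] := pref _ _ cn xE.
    have [x0 [g0 [E0 badE]]] := last_state k.
    have /rcons_inj[_ gE] : rcons x' g = rcons x0 g0 by rewrite x'E.
    by move: gc; rewrite gE badE cE /= eqxx.
  have E1 : input ++ hist N.+1 = x' ++ g :: c :: y by rewrite E xE -!cats1 -!catA.
  have E2 : input ++ hist N.+1 = rcons x' g ++ c :: y by rewrite cat_rcons.
  move: (split_isstep (hist_isstep _) E1) (split_isstep (hist_isstep _) E2).
  rewrite -cats1 !count_cat /= (negbTE cn) => -> /eqP.
  by move: gc; rewrite /bad_next; case: g {xE E1 E2} => [[i|]|d] //=; lia.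
case/lang_ends=> x' [c [xE cacc]].
have cn : isstep c by case: c cacc {xE}.
have [k kN [_ cE]] := pref _ _ cn xE.
by move: cacc; rewrite cE /=; apply/negP/noacc.
Qed.

End History.

(** * Counter machines as queue automata *)
(** In state [q] the machine tests the register [mreg q] for zero, goes on
    according to the outcome, and applies [mop q] to the register: increment,
    truncated decrement, or nothing. *)
Record machine (Q R : finType) := Machine {
  mreg : Q -> R;
  mop : Q -> option bool;
  mgo : Q -> bool -> Q
}.

Definition upd (T : eqType) (x : T -> nat) r n : T -> nat :=
  fun r' => if r' == r then n else x r'.

Definition apply_op (T : eqType) (o : option bool) (r : T) (x : T -> nat) :=
  match o with
  | Some true => upd x r (x r).+1
  | Some false => upd x r (x r).-1
  | None => x
  end.

Definition mstep (Q R : finType) (M : machine Q R) (c : Q * (R -> nat)) :=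
  (mgo M c.1 (0 < c.2 (mreg M c.1)), apply_op (mop M c.1) (mreg M c.1) c.2).

Section Queue.
Variables (Q R I : finType) (M : machine Q R) (q0 : Q) (regs : I -> seq R).

(** The queue is a word over [cell] in which the order does not matter: the
    value of register [r] is the number of letters [Some (Some r)].  [None] marks
    the end of a configuration, and [Some None] is a letter that was erased,
    which is kept so that every step writes at least one letter. *)
Definition cell : finType := option (option R).
Definition letter (r : R) : cell := Some (Some r).

(** One machine step is one pass over the queue up to [None].  The Boolean in
    the state tells whether the tested register has been met in this pass, so
    that its zero test is known when the pass ends. *)
Definition queue_next (c : Q * bool * cell) : Q * bool :=
  let: (q, fl, b) := c in
  match b with
  | None => (mgo M q fl, false)
  | Some (Some r) => (q, fl || (r == mreg M q))
  | Some None => (q, fl)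
  end.

(** An increment is carried out at the end of the pass, a decrement at the first
    letter of the register, if any. *)
Definition queue_out (g : sym I (Q * bool)%type cell) : seq cell :=
  match g with
  | inl None => [:: None]
  | inl (Some i) => map letter (regs i)
  | inr (q, fl, b) =>
    if b == None then
      if mop M q == Some true then [:: letter (mreg M q); None] else [:: None]
    else if (b == letter (mreg M q)) && ~~ fl && (mop M q == Some false)
         then [:: Some None] else [:: b]
  end.

Lemma queue_out_pos g : ~~ isinput g -> 0 < size (queue_out g).
Proof.
by case: g => [[i|]|[[q fl] [[r|]|]]] //= _; do ?case: ifP.
Qed.

Variable v : seq I.
Notation conf := (run_conf None (q0, false) queue_next queue_out v).

Definition mconf t :=
  iter t (mstep M) (q0, fun r => count_mem r (flatten (map regs v))).

Definition onecell q fl (b : cell) : cell :=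
  if (b == letter (mreg M q)) && ~~ fl && (mop M q == Some false)
  then Some None else b.

Fixpoint pass q fl (l : seq cell) : seq cell :=
  if l is b :: l' then onecell q fl b :: pass q (fl || (b == letter (mreg M q))) l'
  else [::].

Lemma queue_pass q fl l l' k : None \notin l ->
  conf k = ((q, fl), l ++ None :: l') ->
  conf (k + size l) = ((q, fl || (letter (mreg M q) \in l)), None :: l' ++ pass q fl l)
  /\ (forall j, j <= size l -> (conf (k + j)).1.1 = q).
Proof.
elim: l fl l' k => [|b l IH] fl l' k.
  rewrite addn0 cats0 orbF => _ kE; split=> [//|j].
  by rewrite leqn0 => /eqP->; rewrite addn0 kE.
rewrite inE negb_or => /andP[bN lN] kE; rewrite /= in kE.
have := IH (fl || (b == letter (mreg M q))) (rcons l' (onecell q fl b)) k.+1 lN.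
case=> [|E1 E2].
  rewrite run_confS kE /queue_step /=; congr (_, _).
    by case: b bN {kE IH} => [[r|]|] //= _; rewrite orbF.
  rewrite eq_sym (negbTE bN) -cats1 -!catA /=; congr (_ ++ _ :: _ ++ _).
  by rewrite /onecell; case: ifP.
split=> [|[|j] jl]; last by rewrite -addSnnS; apply: E2.
- rewrite /= -addSnnS E1 inE -orbA (eq_sym b).
  by rewrite cat_rcons.
by rewrite addn0 kE.
Qed.

Lemma pass_noNone q fl l : None \notin l -> None \notin pass q fl l.
Proof.
elim: l fl => //= b l IH fl; rewrite !inE !negb_or => /andP[bN lN].
by rewrite IH // andbT /onecell; case: ifP.
Qed.

Lemma letterE r r' : (letter r == letter r') = (r == r').
Proof. by apply/eqP/eqP => [[->]|->]. Qed.

Lemma count_pass q fl l r : count_mem (letter r) (pass q fl l) =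
  if (r == mreg M q) && ~~ fl && (mop M q == Some false)
  then (count_mem (letter r) l).-1 else count_mem (letter r) l.
Proof.
elim: l fl => [|b l IH] fl /=; first by case: ifP.
rewrite IH /onecell; have [->|bq] := eqVneq b (letter (mreg M q)).
  rewrite orbT /= !andbF /= letterE (eq_sym (mreg _ _)).
  case: fl; case: (mop M q == Some false); rewrite /= ?letterE ?andbF ?andbT //=;
    rewrite ?(eq_sym (mreg _ _)) //; by case: (r == mreg M q).
rewrite orbF /=; case: ifP => //; case/andP=> /andP[/eqP -> _] _.
by rewrite (negbTE bq).
Qed.

Definition boundary k t :=
  exists l, [/\ None \notin l, conf k = (((mconf t).1, false), rcons l None) &
     forall r, count_mem (letter r) l = (mconf t).2 r].

(** The last clause transfers absorbing and exclusive halting states from the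
    machine to all the intermediate states of the queue automaton. *)
Lemma queue_sim t : exists K, [/\ t <= K, boundary K t &
  forall k, k <= K -> exists t', (conf k).1.1 = (mconf t').1].
Proof.
elim: t => [|t [K [tK [l [lN KE lc]] hK]]].
  exists 0; split=> //; last by case=> // _; exists 0.
  exists (map letter (flatten (map regs v))); split=> /=.
  - by apply/negP => /mapP[].
  - congr (_, _); rewrite /input -cats1 outs_cat cats1; congr rcons.
    by rewrite /outs map_flatten -!map_comp.
  move=> r; rewrite count_map; apply: eq_count => r' /=.
  by rewrite /= letterE.
have KE' : conf K = (((mconf t).1, false), l ++ [:: None]) by rewrite cats1.
have [E1 E2] := queue_pass lN KE'.
exists (K + size l).+1; split; first by lia.
  set q := (mconf t).1 in KE KE' E1 E2.
  exists (pass q false l ++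
    (if mop M q == Some true then [:: letter (mreg M q)] else [::])).
  split.
  - rewrite mem_cat negb_or pass_noNone //=; by case: ifP.
  - rewrite run_confS E1 /queue_step /=.
    have -> : (letter (mreg M q) \in l) = (0 < (mconf t).2 (mreg M q)).
      by rewrite -lc -has_count has_pred1.
    congr (_, _); rewrite -cats1 -catA; congr (_ ++ _); by case: ifP.
  move=> r; rewrite count_cat count_pass lc /= andbT /apply_op -/q.
  case: (mop M q) => [[]|] /=; rewrite /upd; case: eqVneq => [->|rq] //=;
    rewrite ?eqxx ?addn0 ?addn1 //.
  by rewrite letterE eq_sym (negbTE rq) addn0.
move=> k; rewrite leq_eqVlt => /orP[/eqP->|].
  exists t.+1; rewrite run_confS E1 /queue_step /=.
  by rewrite -lc -has_count has_pred1.
rewrite ltnS => kle; have [kK|kK] := leqP k K; first exact: hK.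
exists t; have -> : k = K + (k - K) by lia.
by apply: E2; lia.
Qed.

End Queue.

(** * While programs *)
Inductive cmd :=
| Skip
| Inc (r : nat)
| Dec (r : nat)
| Seq (c d : cmd)
| Loop (r : nat) (c : cmd).

Notation store := (nat -> nat).

Fixpoint loop_rel (E : store -> store -> Prop) r n (s s' : store) : Prop :=
  if n is n'.+1 then 0 < s r /\ exists2 t, E s t & loop_rel E r n' t s'
  else s r = 0 /\ s' = s.

(** Big-step semantics; [loop_rel] counts the iterations, so that proofs about
    loops go by induction on a number. *)
Fixpoint exec (c : cmd) (s s' : store) : Prop :=
  match c with
  | Skip => s' = s
  | Inc r => s' = upd s r (s r).+1
  | Dec r => s' = upd s r (s r).-1
  | Seq c d => exists2 t, exec c s t & exec d t s'
  | Loop r c => exists n, loop_rel (exec c) r n s s'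
  end.

Lemma exec_fun c s t t' : exec c s t -> exec c s t' -> t = t'.
Proof.
elim: c s t t' => [|r|r|c IHc d IHd|r c IHc] s t t' /=; try by move=> -> ->.
  by case=> u su ut [u' su' ut']; rewrite -(IHc _ _ _ su su') in ut'; exact: IHd ut ut'.
case=> n h [n' h']; elim: n n' s h h' => [|n IH] [|n'] s /=.
- by case=> _ -> [_ ->].
- by case=> -> _ [].
- by case=> h _ [h']; rewrite h' in h.
case=> _ [u su ut] [_ [u' su' ut']].
by rewrite -(IHc _ _ _ su su') in ut'; exact: IH ut ut'.
Qed.

Ltac store_ext :=
  apply/funext => ?; rewrite /upd; do ?[case: eqVneq => ? /=]; subst; try lia.

Definition clear r := Loop r (Dec r).
Definition move a b := Loop a (Seq (Dec a) (Inc b)).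
(** Emptying [a] into [b] and a spare register [t] destroys [a]; it is restored
    from [t]. *)
Definition copy a b t :=
  Seq (Loop a (Seq (Dec a) (Seq (Inc b) (Inc t)))) (move t a).

Lemma exec_clear r s : exec (clear r) s (upd s r 0).
Proof.
exists (s r); move E: (s r) => n; elim: n s E => [|n IH] s E /=.
  by split=> //; store_ext.
rewrite E; split=> //; exists (upd s r n) => //.
have -> : upd s r 0 = upd (upd s r n) r 0 by store_ext.
by apply: IH; rewrite /upd eqxx.
Qed.

Lemma exec_move a b s : a != b -> exec (move a b) s (upd (upd s a 0) b (s b + s a)).
Proof.
move=> ab; exists (s a); move E: (s a) => n; elim: n s E => [|n IH] s E.
  by split=> //; store_ext.
split; first by rewrite E.
exists (upd (upd s a n) b (s b).+1).
  exists (upd s a n); first by rewrite /= E.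
  by rewrite /=; store_ext.
set t := upd _ b _.
have -> : upd (upd s a 0) b (s b + n.+1) = upd (upd t a 0) b (t b + n).
  by rewrite /t; store_ext.
by apply: IH; rewrite /t /upd (negbTE ab) eqxx.
Qed.

Lemma exec_copy a b t s : a != b -> a != t -> b != t -> s t = 0 ->
  exec (copy a b t) s (upd s b (s b + s a)).
Proof.
move=> ab at_ bt t0; exists (upd (upd (upd s a 0) b (s b + s a)) t (s a)).
  have -> : upd (upd (upd s a 0) b (s b + s a)) t (s a) =
            upd (upd (upd s a 0) b (s b + s a)) t (s t + s a) by rewrite t0.
  exists (s a); move E: (s a) => n; elim: n s E {t0} => [|n IH] s E.
    by split=> //; store_ext.
  split; first by rewrite E.
  exists (upd (upd (upd s a n) b (s b).+1) t (s t).+1).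
    exists (upd s a n); first by rewrite /= E.
    exists (upd (upd s a n) b (s b).+1) => /=.
      by store_ext.
    by rewrite /=; store_ext.
  set u := upd _ t (s t).+1.
  have -> : upd (upd (upd s a 0) b (s b + n.+1)) t (s t + n.+1)
          = upd (upd (upd u a 0) b (u b + n)) t (u t + n).
    by rewrite /u; store_ext.
  by apply: IH; rewrite /u /upd (negbTE ab) (negbTE at_) eqxx.
set u := upd _ t _.
have -> : upd s b (s b + s a) = upd (upd u t 0) a (u a + u t).
  by rewrite /u; store_ext.
by apply: exec_move; rewrite eq_sym.
Qed.

(** * Compiling recursive functions to while programs *)
(** [compile f ins o b] adds the value of [f] at the registers [ins] to the
    register [o], using as scratch only registers from [b] on.  These are zero
    before and after, which lets the code of subterms be nested.  Primitive
    recursion keeps the accumulator in [b], the index in [b.+1], the remaining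
    number of rounds in [b.+2] and the new value in [b.+3]; minimisation keeps
    the candidate in [b] and the value there in [b.+1]. *)
Fixpoint compile n (f : recfun n) (ins : seq nat) (o b : nat) {struct f} : cmd :=
  match f with
  | RZero => Skip
  | RSucc => Seq (copy (head 0 ins) o b) (Inc o)
  | RProj _ i => copy (nth 0 ins i) o b
  | RComp m _ f g =>
      Seq (foldr (fun i : 'I_m => Seq (compile (g i) ins (b + i) (b + m))) Skip
                 (enum 'I_m))
     (Seq (compile f (iota b m) o (b + m))
          (foldr (fun r => Seq (clear r)) Skip (iota b m)))
  | RRec _ f g =>
      Seq (compile f (behead ins) b b.+4)
     (Seq (copy (head 0 ins) b.+2 b.+4)
     (Seq (Loop b.+2 (Seq (Dec b.+2)
                     (Seq (compile g (b.+1 :: b :: behead ins) b.+3 b.+4)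
                     (Seq (clear b) (Seq (move b.+3 b) (Inc b.+1))))))
     (Seq (move b o) (clear b.+1))))
  | RMin _ f =>
      Seq (compile f (b :: ins) b.+1 b.+2)
     (Seq (Loop b.+1 (Seq (clear b.+1)
                     (Seq (Inc b) (compile f (b :: ins) b.+1 b.+2))))
          (move b o))
  end.

(** The equivalence states correctness and non-termination at once: the code
    terminates only if [f] is defined. *)
Definition compile_spec n (f : recfun n) := forall ins o b (s s' : store),
  size ins = n -> all (ltn^~ b) ins -> o < b -> o \notin ins ->
  (forall r, b <= r -> s r = 0) ->
  (exec (compile f ins o b) s s' <->
   exists2 y, eval f (map s ins) y & s' = upd s o (s o + y)).

Lemma exec_Seq c d s s' :
  exec (Seq c d) s s' <-> exists2 t, exec c s t & exec d t s'.
Proof. by []. Qed.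

Lemma exec_seq_tot c d s t s' : exec c s t -> (exec (Seq c d) s s' <-> exec d t s').
Proof.
move=> ct; split=> [[t' ct' dt]|]; last by exists t.
by rewrite (exec_fun ct ct').
Qed.

Lemma exec_tot c s t s' : exec c s t -> (exec c s s' <-> s' = t).
Proof. by move=> ct; split=> [/(exec_fun ct)|->]. Qed.

Lemma map_upd (s : store) r n (l : seq nat) :
  r \notin l -> map (upd s r n) l = map s l.
Proof.
move=> rl; apply/eq_in_map => x xl; rewrite /upd.
by case: eqVneq xl rl => // -> ->.
Qed.

Lemma compile_zero : compile_spec RZero.
Proof.
move=> ins o b s s' _ _ _ _ _ /=; split=> [->|[y -> ->]].
  by exists 0 => //; store_ext.
by store_ext.
Qed.

Lemma lt_notin b r (l : seq nat) : all (ltn^~ b) l -> b <= r -> r \notin l.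
Proof. by move=> lb br; apply/negP => /(allP lb) /=; lia. Qed.

Lemma compile_proj n (i : 'I_n) : compile_spec (RProj i).
Proof.
move=> ins o b s s' si ib ob oi s0; rewrite [compile _ _ _ _]/=.
have xi : nth 0 ins i \in ins by rewrite mem_nth // si.
have xb := allP ib _ xi; rewrite /= in xb.
have xo : nth 0 ins i != o by apply: contraNneq oi => <-.
have cp : exec (copy (nth 0 ins i) o b) s (upd s o (s o + s (nth 0 ins i))).
  by apply: exec_copy => //; [lia | lia | exact: s0].
rewrite (exec_tot s' cp) /=.
split=> [->|[y -> ->]]; last by rewrite (nth_map 0) ?si.
by exists (s (nth 0 ins i)) => //; rewrite (nth_map 0) ?si.
Qed.

Lemma compile_succ : compile_spec RSucc.
Proof.
move=> [|x [|]] // o b s s' _; rewrite [all _ _]/= andbT inE => xb ob ox s0.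
have xo : x != o by rewrite eq_sym.
have cp : exec (copy x o b) s (upd s o (s o + s x)).
  by apply: exec_copy => //; [lia | lia | exact: s0].
rewrite [compile _ _ _ _]/= (exec_seq_tot _ _ cp) /=.
have -> : forall y, upd (upd s o y) o (upd s o y o).+1 = upd s o y.+1.
  by move=> y; apply/funext => r; rewrite /upd eqxx; case: eqP.
by split=> [->|[y -> ->]]; [exists (s x).+1 => // |]; rewrite addnS.
Qed.

Fixpoint addl (s : store) (rs ys : seq nat) : store :=
  match rs, ys with
  | r :: rs, y :: ys => addl (upd s r (s r + y)) rs ys
  | _, _ => s
  end.

Lemma addl_iota s b m ys r : size ys = m ->
  addl s (iota b m) ys r =
  if b <= r < b + m then s r + nth 0 ys (r - b) else s r.
Proof.
elim: m b s ys => [|m IH] b s [|y ys] //=; first by case: ifP => //; lia.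
case=> sy; rewrite IH // /upd; case: (eqVneq r b) => [->|rb].
  by rewrite ltnn /= subnn leqnn /=; case: ifP => //; lia.
case: ifP => h; last by case: ifP => //; lia.
have -> : b <= r < b + m.+1 by lia.
by have -> : r - b = (r - b.+1).+1 by lia.
Qed.

Lemma exec_clears s b m :
  exec (foldr (fun r => Seq (clear r)) Skip (iota b m)) s
       (fun r => if b <= r < b + m then 0 else s r).
Proof.
elim: m b s => [|m IH] b s /=.
  by apply/funext => r; case: ifP => //; lia.
exists (upd s b 0); first exact: exec_clear.
have := IH b.+1 (upd s b 0); congr exec; apply/funext => r; rewrite /upd.
by case: (eqVneq r b) => [->|rb]; do ?case: ifP => //; lia.
Qed.

Lemma compile_comp m n (f : recfun m) (g : 'I_m -> recfun n) :
  compile_spec f -> (forall i, compile_spec (g i)) -> compile_spec (RComp f g).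
Proof.
move=> IHf IHg ins o b s s' si ib ob oi s0.
have gs (l : seq 'I_m) t t' :
    (forall r, b + m <= r -> t r = 0) -> map t ins = map s ins ->
    exec (foldr (fun i : 'I_m => Seq (compile (g i) ins (b + i) (b + m))) Skip l) t t' <->
    exists ys, [/\ size ys = size l,
      forall k, k < size l -> forall i, i = nth i l k ->
        eval (g i) (map s ins) (nth 0 ys k) &
      t' = addl t [seq b + nat_of_ord i | i <- l] ys].
  elim: l t t' => [|i l IH] t t' t0 tE.
    by split=> [->|[[|y ys] [] // _ _ ->]]; first by exists [::].
  have fresh : b + i \notin ins by apply: lt_notin ib _; lia.
  have ib' : all (ltn^~ (b + m)) ins by apply: sub_all ib => x /=; lia.
  have im : b + i < b + m by rewrite ltn_add2l.
  have spec t1 := IHg i ins (b + i) (b + m) t t1 si ib' im fresh t0.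
  rewrite [foldr _ _ _]/= exec_Seq; split=> [[t1 /spec[y ye ->]]|].
    rewrite IH ?map_upd //; last first.
      by move=> r hr; rewrite /upd; case: eqP => [|_]; [lia | exact: t0].
    case=> ys [sys ev ->]; exists (y :: ys); split=> //=; first by rewrite sys.
    move=> [|k] kl j /= jE; last exact: ev.
    by rewrite jE -tE.
  case=> [[|y ys] [//= [sys] ev ->]].
  exists (upd t (b + i) (t (b + i) + y)).
    by apply/spec => //; exists y => //; rewrite tE; apply: (ev 0).
  rewrite IH ?map_upd //; last first.
    by move=> r hr; rewrite /upd; case: eqP => [|_]; [lia | exact: t0].
  by exists ys; split=> // k kl; apply: (ev k.+1).
have iotaE : [seq b + nat_of_ord i | i <- enum 'I_m] = iota b m.
  by rewrite map_comp val_enum_ord -iotaDl addn0.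
have s0' r : b + m <= r -> s r = 0 by move=> h; apply: s0; lia.
have main ys : size ys = m -> forall s',
   exec (Seq (compile f (iota b m) o (b + m))
          (foldr (fun r => Seq (clear r)) Skip (iota b m))) (addl s (iota b m) ys) s' <->
   exists2 y, eval f ys y & s' = upd s o (s o + y).
  move=> sys s1; set t := addl _ _ _.
  have tE r : t r = if b <= r < b + m then nth 0 ys (r - b) else s r.
    rewrite /t addl_iota //; case: ifP => // h.
    by rewrite s0 //; case/andP: h.
  have argE : map t (iota b m) = ys.
    apply: (@eq_from_nth _ 0); rewrite size_map size_iota // => k km.
    rewrite (nth_map 0) ?size_iota // nth_iota // tE.
    have -> : b <= b + k < b + m by lia.
    by rewrite addKn.
  have spec t1 : exec (compile f (iota b m) o (b + m)) t t1 <->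
      exists2 y, eval f ys y & t1 = upd t o (t o + y).
    rewrite IHf ?size_iota ?argE //.
    - by apply/allP => x; rewrite mem_iota /=; lia.
    - by lia.
    - by rewrite mem_iota; lia.
    by move=> r hr; rewrite tE; case: ifP => [|_]; [lia|exact: s0'].
  have clr y : exec (foldr (fun r => Seq (clear r)) Skip (iota b m))
                 (upd t o (t o + y)) (upd s o (s o + y)).
    have := exec_clears (upd t o (t o + y)) b m; congr exec.
    apply/funext => r; rewrite /upd !tE; have -> : (b <= o < b + m) = false by lia.
    case: (eqVneq r o) => [->|ro]; first by case: ifP => //; lia.
    by case h: (_ <= _ < _) => //; rewrite s0 //; case/andP: h.
  rewrite exec_Seq; split=> [[t1 /spec[y ye ->] h]|[y ye ->]].
    by exists y => //; apply: exec_fun h (clr y).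
  by exists (upd t o (t o + y)) => //; apply/spec; exists y.
rewrite [compile _ _ _ _]/= exec_Seq.
split=> [[t1 /gs[//|//|ys [sys ev ->]]]|[y [w [sw ev fe]] ->]].
  rewrite size_enum_ord in sys ev; rewrite iotaE => /(main _ sys)[y ye ->].
  exists y => //; exists ys; split=> // i.
  by apply: ev => //; rewrite nth_ord_enum.
exists (addl s (iota b m) w); last by apply/main => //; exists y.
apply/gs => //; exists w; rewrite size_enum_ord iotaE; split=> // k km i ->.
have kE : nth i (enum 'I_m) k = Ordinal km by apply: val_inj; rewrite /= nth_enum_ord.
by rewrite kE; apply: ev (Ordinal km).
Qed.

(** [rec_graph] read from the inside out, in the order in which the loop computes
    it: [t] rounds starting with index [j] and accumulator [a]. *)
Fixpoint rec_chain (G : seq nat -> nat -> Prop) v j t a y : Prop :=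
  if t is t'.+1 then exists2 z, G [:: j, a & v] z & rec_chain G v j.+1 t' z y
  else y = a.

Lemma rec_chainP F G v k y :
  rec_graph F G v k y <-> exists2 a, F v a & rec_chain G v 0 k a y.
Proof.
suff H t j : rec_graph F G v (j + t) y <->
    exists2 a, rec_graph F G v j a & rec_chain G v j t a y by exact: (H k 0).
elim: t j => [|t IH] j; first by rewrite addn0; split=> [|[a ha ->]] //; exists y.
rewrite addnS -addSn IH; split=> [[a [z hz gz] ha]|[z hz [a ga ha]]].
  by exists z => //; exists a.
by exists a => //; exists z.
Qed.

Section Rec.
Variables (n : nat) (f : recfun n) (g : recfun n.+2).
Hypotheses (IHf : compile_spec f) (IHg : compile_spec g).
Variables (x : nat) (ins : seq nat) (o b : nat).
Hypotheses (si : size ins = n) (xb : x < b) (ib : all (ltn^~ b) ins).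

Let body := Seq (Dec b.+2)
             (Seq (compile g (b.+1 :: b :: ins) b.+3 b.+4)
             (Seq (clear b) (Seq (move b.+3 b) (Inc b.+1)))).

Variable s : store.
Hypothesis s0 : forall r, b <= r -> s r = 0.

(* The store between two rounds: index, remaining rounds, accumulator. *)
Let st j t a : store := upd (upd (upd s b a) b.+1 j) b.+2 t.

Lemma st_ins j t a : map (st j t a) ins = map s ins.
Proof. by rewrite !map_upd //; apply: lt_notin ib _; lia. Qed.

Lemma exec_body j t a s' : exec body (st j t.+1 a) s' <->
  exists2 z, eval g [:: j, a & map s ins] z & s' = st j.+1 t z.
Proof.
have dec : exec (Dec b.+2) (st j t.+1 a) (st j t a).
  by rewrite /= /st; store_ext.
rewrite (exec_seq_tot _ _ dec).
have spec t1 : exec (compile g (b.+1 :: b :: ins) b.+3 b.+4) (st j t a) t1 <->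
    exists2 z, eval g [:: j, a & map s ins] z & t1 = upd (st j t a) b.+3 z.
  rewrite IHg /= ?si ?st_ins.
  - have -> : st j t a b.+1 = j by rewrite /st /upd; do ?[case: eqVneq => ? //=]; lia.
    have -> : st j t a b = a by rewrite /st /upd; do ?[case: eqVneq => ? //=]; lia.
    have -> // : st j t a b.+3 = 0.
    by rewrite /st /upd; do ?[case: eqVneq => ? //=]; first [lia | apply: s0; lia].
  - by [].
  - by apply/and3P; split; [lia|lia|apply: sub_all ib => r /=; lia].
  - by lia.
  - by rewrite !inE !negb_or; apply/and3P; split; [lia|lia|apply: lt_notin ib _; lia].
  by move=> r hr; rewrite /st /upd; do ?[case: eqVneq => ? //=]; first [lia | apply: s0; lia].
have tail z : exec (Seq (clear b) (Seq (move b.+3 b) (Inc b.+1)))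
                 (upd (st j t a) b.+3 z) (st j.+1 t z).
  exists (upd (upd (st j t a) b.+3 z) b 0); first exact: exec_clear.
  exists (st j t z).
    have h : b.+3 != b by lia.
    have := exec_move (upd (upd (st j t a) b.+3 z) b 0) h; congr exec.
    rewrite /st; apply/funext => r; rewrite /upd; do ?[case: eqVneq => ? //=]; subst; try lia.
    by rewrite s0 //; lia.
  by rewrite /= /st; store_ext.
rewrite exec_Seq; split=> [[t1 /spec[z hz ->] h]|[z hz ->]].
  by exists z => //; apply: exec_fun h (tail z).
by exists (upd (st j t a) b.+3 z) => //; apply/spec; exists z.
Qed.

Lemma exec_rec_loop j t a s' : exec (Loop b.+2 body) (st j t a) s' <->
  exists2 y, rec_chain (eval g) (map s ins) j t a y & s' = st (j + t) 0 y.
Proof.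
have stE j' t' a' : st j' t' a' b.+2 = t' by rewrite /st /upd eqxx.
split.
  case=> k; elim: k j t a => [|k IH] j t a.
    by case; rewrite stE => -> ->; exists a; rewrite ?addn0.
  case; rewrite stE; case: t => // t _ [t1 /exec_body[z hz ->] /IH[y hy ->]].
  by exists y; [exists z|rewrite addSnnS].
case=> y; elim: t j a => [|t IH] j a.
  by move=> -> ->; exists 0; rewrite /= stE addn0.
case=> z hz hy s'E.
have [k hk] := IH _ _ hy (etrans s'E (congr1 (fun k => st k 0 y) (addnS j t))).
exists k.+1; split; first by rewrite stE.
by exists (st j.+1 t z) => //; apply/exec_body; exists z.
Qed.

Hypotheses (ob : o < b) (oi : o \notin ins).

Lemma compile_rec_cons s' : exec (compile (RRec f g) (x :: ins) o b) s s' <->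
  exists2 y, eval (RRec f g) (map s (x :: ins)) y & s' = upd s o (s o + y).
Proof.
have spec t1 : exec (compile f ins b b.+4) s t1 <->
    exists2 a, eval f (map s ins) a & t1 = st 0 0 a.
  rewrite IHf //.
  - have E a : upd s b (s b + a) = st 0 0 a.
      rewrite /st; apply/funext => r; rewrite /upd.
      by do ?[case: eqVneq => ? //=]; subst; try lia; rewrite s0 //; lia.
    by split=> -[a ha ->]; exists a; rewrite ?E.
  - by apply: sub_all ib => r /=; lia.
  - by lia.
  - by apply: lt_notin ib _.
  by move=> r hr; apply: s0; lia.
have cpy a : exec (copy x b.+2 b.+4) (st 0 0 a) (st 0 (s x) a).
  have h1 : x != b.+2 by lia.
  have h2 : x != b.+4 by lia.
  have h3 : b.+2 != b.+4 by lia.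
  have h4 : st 0 0 a b.+4 = 0.
    by rewrite /st /upd; do ?[case: eqVneq => ? //=]; first [lia | apply: s0; lia].
  have := exec_copy h1 h2 h3 h4; congr exec.
  by rewrite /st; apply/funext => r; rewrite /upd; do ?[case: eqVneq => ? //=]; subst; lia.
have tail k y : exec (Seq (move b o) (clear b.+1)) (st k 0 y) (upd s o (s o + y)).
  exists (upd (upd (st k 0 y) b 0) o (st k 0 y o + st k 0 y b)).
    by apply: exec_move; lia.
  have := exec_clear b.+1 (upd (upd (st k 0 y) b 0) o (st k 0 y o + st k 0 y b)).
  congr exec; rewrite /st; apply/funext => r; rewrite /upd.
  by do ?[case: eqVneq => ? //=]; subst; try lia; rewrite s0 //; lia.
have -> : eval (RRec f g) (map s (x :: ins)) =
  rec_graph (eval f) (eval g) (map s ins) (s x) by [].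
rewrite [compile _ _ _ _]/= exec_Seq; split.
  case=> t1 /spec[a ha ->]; rewrite (exec_seq_tot _ _ (cpy a)) exec_Seq.
  case=> t2 /exec_rec_loop[y hy ->] h.
  exists y; last exact: exec_fun h (tail _ y).
  by apply/rec_chainP; exists a.
case=> y /rec_chainP[a ha hy] ->; exists (st 0 0 a); first by apply/spec; exists a.
apply/(exec_seq_tot _ _ (cpy a)); exists (st (0 + s x) 0 y); last exact: tail.
by apply/exec_rec_loop; exists y.
Qed.

End Rec.

Lemma compile_rec n (f : recfun n) (g : recfun n.+2) :
  compile_spec f -> compile_spec g -> compile_spec (RRec f g).
Proof.
move=> IHf IHg [//|x ins] o b s s' [si] /andP[xb ib] ob.
rewrite inE negb_or => /andP[_ oi] s0.
exact: (compile_rec_cons IHf IHg si xb ib s0 ob oi s').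
Qed.

Lemma compile_min n (f : recfun n.+1) : compile_spec f -> compile_spec (RMin f).
Proof.
move=> IHf ins o b s s' si ib ob oi s0.
(* The store while the candidate y, with value z, is tried. *)
pose st y z : store := upd (upd s b y) b.+1 z.
pose v := map s ins.
have spec y s1 : exec (compile f (b :: ins) b.+1 b.+2) (st y 0) s1 <->
    exists2 z, eval f (y :: v) z & s1 = st y z.
  rewrite IHf /= ?si //.
  - have -> : map (st y 0) ins = v.
      by rewrite !map_upd //; apply: lt_notin ib _; lia.
    have -> : st y 0 b = y by rewrite /st /upd; do ?[case: eqVneq => ? //=]; lia.
    have E z : upd (st y 0) b.+1 (st y 0 b.+1 + z) = st y z.
      by rewrite /st; apply/funext => r; rewrite /upd; do ?[case: eqVneq => ? //=]; lia.
    by split=> -[z hz ->]; exists z; rewrite ?E.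
  - by apply/andP; split; [lia|apply: sub_all ib => r /=; lia].
  - by rewrite inE negb_or; apply/andP; split; [lia|apply: lt_notin ib _; lia].
  by move=> r hr; rewrite /st /upd; do ?[case: eqVneq => ? //=]; first [lia | apply: s0; lia].
pose body := Seq (clear b.+1) (Seq (Inc b) (compile f (b :: ins) b.+1 b.+2)).
have bodyE y z s1 : exec body (st y z) s1 <->
    exists2 z', eval f (y.+1 :: v) z' & s1 = st y.+1 z'.
  have h1 : exec (clear b.+1) (st y z) (st y 0).
    by have := exec_clear b.+1 (st y z); congr exec; rewrite /st; store_ext.
  have h2 : exec (Inc b) (st y 0) (st y.+1 0).
    by rewrite /= /st; store_ext.
  by rewrite (exec_seq_tot _ _ h1) (exec_seq_tot _ _ h2) spec.
have sb y z : st y z b.+1 = z by rewrite /st /upd eqxx.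
have tail y : exec (move b o) (st y 0) (upd s o (s o + y)).
  have h : b != o by lia.
  have := exec_move (st y 0) h; congr exec; rewrite /st; apply/funext => r; rewrite /upd.
  by do ?[case: eqVneq => ? //=]; subst; try lia; rewrite s0 //; lia.
have start : s = st 0 0.
  rewrite /st; apply/funext => r; rewrite /upd.
  by do ?[case: eqVneq => ? //=]; subst; try lia; rewrite s0 //; lia.
rewrite [compile _ _ _ _]/= exec_Seq; split.
  rewrite {1}start; case=> t1 /spec[z hz ->] /exec_Seq[t2 [k hk] h].
  have : exists2 y, eval (RMin f) v y & t2 = st y 0; last first.
    by case=> y hy t2E; exists y => //; apply: (exec_fun h); rewrite t2E; apply: tail.
  suff H y0 : (forall x, x < y0 -> exists t, eval f (x :: v) t.+1) ->
      eval f (y0 :: v) z -> loop_rel (exec body) b.+1 k (st y0 z) t2 ->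
      exists2 y, eval (RMin f) v y & t2 = st y 0 by exact: (H 0).
  elim: k y0 z {hz hk h t1} => [|k IH] y z low hz.
    by case; rewrite sb => z0 ->; rewrite z0 in hz *; exists y.
  case; rewrite sb => zpos [t3 /bodyE[z' hz' ->]] /IH; apply=> // x.
  rewrite ltnS leq_eqVlt => /orP[/eqP->|]; last exact: low.
  by exists z.-1; rewrite prednK.
case=> y [/= hy low] ->; rewrite {1}start.
suff H k : k <= y -> exists z, eval f (y - k :: v) z /\
    exec (Loop b.+1 body) (st (y - k) z) (st y 0).
  have [z [hz hl]] := H _ (leqnn y); rewrite subnn in hz hl.
  exists (st 0 z); first by apply/spec; exists z.
  by exists (st y 0) => //; apply: tail.
elim: k => [|k IH] ky.
  by exists 0; rewrite subn0; split=> //; exists 0; rewrite /= sb.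
have [z [hz [m hm]]] := IH (ltnW ky).
have [t ht] : exists t, eval f (y - k.+1 :: v) t.+1 by apply: low; lia.
exists t.+1; split=> //; exists m.+1; split; first by rewrite sb.
exists (st (y - k) z) => //; apply/bodyE.
have -> : (y - k.+1).+1 = y - k by lia.
by exists z.
Qed.

Theorem compile_correct n (f : recfun n) : compile_spec f.
Proof.
elim: n / f => [||n i|m n f IHf g IHg|n f IHf g IHg|n f IHf].
- exact: compile_zero.
- exact: compile_succ.
- exact: compile_proj.
- exact: compile_comp.
- exact: compile_rec.
exact: compile_min.
Qed.

(** * While programs as finite-state machines *)
HB.instance Definition _ := gen_eqMixin cmd.
HB.instance Definition _ := gen_choiceMixin cmd.

(** A control point is the list of commands that remain to be executed, and a
    step splits or executes the first one.  Only finitely many such lists arise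
    from a given program ([kstates]), which makes it a finite-state machine
    without any assignment of addresses. *)
Definition kreg (K : seq cmd) : nat :=
  match K with
  | Inc r :: _ | Dec r :: _ | Loop r _ :: _ => r
  | _ => 0
  end.

Definition kop (K : seq cmd) : option bool :=
  match K with
  | Inc _ :: _ => Some true
  | Dec _ :: _ => Some false
  | _ => None
  end.

Definition knext (K : seq cmd) (b : bool) : seq cmd :=
  match K with
  | [::] => [::]
  | Skip :: K' | Inc _ :: K' | Dec _ :: K' => K'
  | Seq c d :: K' => c :: d :: K'
  | Loop _ c :: K' => if b then c :: K else K'
  end.

Definition kstep (k : seq cmd * store) : seq cmd * store :=
  (knext k.1 (0 < k.2 (kreg k.1)), apply_op (kop k.1) (kreg k.1) k.2).

Definition krun c s n := iter n kstep ([:: c], s).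

Lemma exec_ksteps c s t K : exec c s t -> exists n, iter n kstep (c :: K, s) = (K, t).
Proof.
elim: c s t K => [|r|r|c IHc d IHd|r c IHc] s t K.
- by move=> ->; exists 1.
- by move=> ->; exists 1.
- by move=> ->; exists 1.
- case/exec_Seq=> u /IHc-/(_ (d :: K))[n nE] /IHd-/(_ K)[m mE].
  by exists (m + n).+1; rewrite iterSr iterD [kstep _]/= nE mE.
case=> k; elim: k s => [|k IH] s.
  by case=> s0 ->; exists 1; rewrite /= /kstep /= s0.
case=> sr [u /IHc-/(_ (Loop r c :: K))[n nE] /IH[m mE]].
by exists (m + n).+1; rewrite iterSr iterD /kstep /= sr nE mE.
Qed.

(** Bounding the remaining number of steps by [n] lets the same induction serve
    for the two parts of a sequence and for the rounds of a loop. *)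
Lemma ksteps_exec n c s K : (iter n kstep (c :: K, s)).1 = [::] ->
  exists m t, [/\ m < n, exec c s t & (iter m kstep (K, t)).1 = [::]].
Proof.
elim/ltn_ind: n c s K => -[|n] IH c s K //.
rewrite iterSr; case: c => [|r|r|c d|r c]; rewrite {2}/kstep /=.
- by move=> h; exists n, s.
- by move=> h; exists n, (upd s r (s r).+1).
- by move=> h; exists n, (upd s r (s r).-1).
- move=> /IH-/(_ (ltnSn _))[m [t [mn ct /IH]]].
  case=> [|m' [t' [mm dt h]]]; first by lia.
  by exists m', t'; split=> //; [lia | exists t].
case: ltnP => sr h; last first.
  by exists n, s; split=> //; exists 0; split=> //; lia.
have [m [t [mn ct /IH]]] := IH n (ltnSn _) _ _ _ h.
case=> [|m' [t' [mm [k lt] h']]]; first by lia.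
exists m', t'; split=> //; first by lia.
by exists k.+1; split=> //; exists t.
Qed.

Lemma halts_exec c s : (exists n, (krun c s n).1 = [::]) <-> exists t, exec c s t.
Proof.
split=> [[n /ksteps_exec[m [t [_ ct _]]]]|[t /exec_ksteps-/(_ [::])[n nE]]].
  by exists t.
by exists n; rewrite /krun nE.
Qed.

(** The control points met before [c] is finished and [K] takes over. *)
Fixpoint reach (c : cmd) (K : seq cmd) : seq (seq cmd) :=
  (c :: K) :: match c with
              | Seq c1 c2 => reach c1 (c2 :: K) ++ reach c2 K
              | Loop _ c' => reach c' (c :: K)
              | _ => [::]
              end.

Lemma reach_head c K : c :: K \in reach c K.
Proof. by case: c => *; rewrite inE eqxx. Qed.

Lemma knext_reach c K K' b : K' \in reach c K ->
  knext K' b \in K :: reach c K.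
Proof.
elim: c K K' => [|r|r|c IHc d IHd|r c IHc] K K'; rewrite [reach _ _]/= !inE.
1-3: by move=> /eqP->; rewrite eqxx.
- rewrite !mem_cat; case/or3P => [/eqP->|/IHc|/IHd].
  + by rewrite /= reach_head !orbT.
  + by rewrite inE => /orP[/eqP->|->]; rewrite ?reach_head !orbT.
  by rewrite inE => /orP[->|->]; rewrite ?orbT.
case/orP=> [/eqP->|/IHc] /=.
  by case: (b); rewrite ?eqxx ?reach_head ?orbT.
by rewrite inE => /orP[/eqP->|->]; rewrite ?eqxx ?orbT.
Qed.

Fixpoint cmd_bound (c : cmd) : nat :=
  match c with
  | Skip => 1
  | Inc r | Dec r => r.+1
  | Seq c d => maxn (cmd_bound c) (cmd_bound d)
  | Loop r c => maxn r.+1 (cmd_bound c)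
  end.

Lemma cmd_bound_gt0 c : 0 < cmd_bound c.
Proof. by elim: c => //= *; lia. Qed.

Lemma kreg_reach c K K' : K' \in reach c K -> kreg K' < cmd_bound c.
Proof.
elim: c K K' => [|r|r|c IHc d IHd|r c IHc] K K'; rewrite [reach _ _]/= !inE.
1-3: by move=> /eqP->.
- rewrite mem_cat => /or3P[/eqP->|/IHc|/IHd] /=; rewrite leq_max.
  + by rewrite cmd_bound_gt0.
  + by move=> ->.
  by move=> ->; rewrite orbT.
case/orP=> [/eqP->|/IHc] /=; rewrite leq_max; first by rewrite ltnSn.
by move=> ->; rewrite orbT.
Qed.

Definition kstates c := [::] :: reach c [::].

Lemma knext_states c K b : K \in kstates c -> knext K b \in kstates c.
Proof. by rewrite !inE => /orP[/eqP->//|/knext_reach-/(_ b)]; rewrite inE. Qed.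

Lemma kreg_states c K : K \in kstates c -> kreg K < cmd_bound c.
Proof. by rewrite inE => /orP[/eqP->|/kreg_reach //]; exact: cmd_bound_gt0. Qed.

Definition knextS c (q : seq_sub (kstates c)) b : seq_sub (kstates c) :=
  SeqSub (knext_states b (ssvalP q)).

(** * Running two programs in parallel *)
Section Parallel.
Variables (c1 c2 : cmd).

Definition maxreg := maxn (cmd_bound c1) (maxn (cmd_bound c2) 3).
(** The Boolean tells whose turn it is: true for [c1].  Each program has a copy of
    the registers of its own, told apart by the same Boolean.  The machine stops
    for good as soon as one of the programs has finished. *)
Definition pstate : finType :=
  (seq_sub (kstates c1) * seq_sub (kstates c2) * bool)%type.
Definition preg : finType := (bool * 'I_maxreg.+1)%type.

Definition halted1 (q : pstate) := ssval q.1.1 == [::].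
Definition halted2 (q : pstate) := ssval q.1.2 == [::].
Definition phalted q := halted1 q || halted2 q.

Definition pcur (q : pstate) : seq cmd :=
  if q.2 then ssval q.1.1 else ssval q.1.2.

Definition pmachine : machine pstate preg := Machine
  (fun q => (q.2, inord (kreg (pcur q))))
  (fun q => if phalted q then None else kop (pcur q))
  (fun q x => if phalted q then q else
     if q.2 then (knextS q.1.1 x, q.1.2, false) else (q.1.1, knextS q.1.2 x, true)).

Definition pstart : pstate :=
  (SeqSub (mem_behead (s := kstates c1) (reach_head c1 [::])),
   SeqSub (mem_behead (s := kstates c2) (reach_head c2 [::])), true).

(** The input is written into the registers of both programs. *)
Definition pregs (i : 'I_3) : seq preg := [:: (true, inord i); (false, inord i)].

Variables (v : seq 'I_3) (s : store).
Hypothesis sE : forall r, s r = count (fun i : 'I_3 => nat_of_ord i == r) v.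

Notation pconf := (mconf pmachine pstart pregs v).

Lemma kreg_lt1 K : K \in kstates c1 -> kreg K < maxreg.+1.
Proof. by move/kreg_states; rewrite /maxreg; lia. Qed.
Lemma kreg_lt2 K : K \in kstates c2 -> kreg K < maxreg.+1.
Proof. by move/kreg_states; rewrite /maxreg; lia. Qed.

(** As long as nothing has halted, [t] steps of the machine are [uphalf t] steps of
    the first program and [t./2] of the second; afterwards only the halting
    configurations are recorded. *)
Lemma pconf_sim t : exists n1 n2,
  [/\ ssval (pconf t).1.1.1 = (krun c1 s n1).1,
      ssval (pconf t).1.1.2 = (krun c2 s n2).1,
      forall i : 'I_maxreg.+1, (pconf t).2 (true, i) = (krun c1 s n1).2 i,
      forall i : 'I_maxreg.+1, (pconf t).2 (false, i) = (krun c2 s n2).2 i &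
      phalted (pconf t).1 \/
        [/\ (pconf t).1.2 = ~~ odd t, n1 = uphalf t & n2 = t./2]].
Proof.
elim: t => [|t [n1 [n2 [E1 E2 R1 R2 H]]]].
  have cnt b (i : 'I_maxreg.+1) : count_mem (b, i) (flatten (map pregs v)) = s i.
    rewrite sE; elim: v => //= j w IH; rewrite -/(count_mem _) IH.
    have jE : (inord j == i :> 'I_maxreg.+1) = (nat_of_ord j == i).
      rewrite -val_eqE /= inordK //.
      by have := ltn_ord j; rewrite /maxreg; lia.
    by rewrite !xpair_eqE !jE; case: (b) => /=; rewrite ?andbF ?add0n.
  by exists 0, 0; split=> //; [move=> i; apply: cnt | move=> i; apply: cnt | right].
rewrite /mconf iterS -/(mconf _ _ _ _ _).
case: (mconf _ _ _ _ _) E1 E2 R1 R2 H => [[[q1 q2] b] x] /= E1 E2 R1 R2 H.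
rewrite /mstep /=; case: ifP => hq; first by exists n1, n2; split=> //; left.
case: H => [h|[bE nE1 nE2]]; first by rewrite h in hq.
have updE o K (y : store) c : kreg K < maxreg.+1 ->
    (forall i : 'I_maxreg.+1, x (c, i) = y i) ->
    forall i : 'I_maxreg.+1, apply_op o ((c, inord (kreg K)) : preg) x (c, i) =
      apply_op o (kreg K) y i.
  move=> Klt xy i; case: o => [o|//]; rewrite /apply_op.
  have iE : ((c, i) == (c, inord (kreg K)) :> preg) = (nat_of_ord i == kreg K).
    by rewrite xpair_eqE eqxx /= -val_eqE /= inordK.
  by case: o; rewrite /upd iE !xy inordK.
have updN o K c i : apply_op o ((c, inord (kreg K)) : preg) x (~~ c, i) = x (~~ c, i).
  by case: o => [[]|//]; rewrite /apply_op /upd xpair_eqE; case: c.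
case: b bE hq => bE hq; rewrite /pcur /=.
  have Klt := kreg_lt1 (ssvalP q1).
  exists n1.+1, n2; rewrite /krun iterS -/(krun c1 s n1) /kstep -E1; split=> //=.
  - by rewrite R1 inordK.
  - by move=> i; apply: updE.
  - by move=> i; rewrite (updN _ _ true).
  right; split; [by rewrite -bE|by rewrite nE1 uphalf_half; lia|by lia].
have Klt := kreg_lt2 (ssvalP q2).
exists n1, n2.+1; rewrite /krun iterS -/(krun c2 s n2) /kstep -E2; split=> //=.
- by rewrite R2 inordK.
- by move=> i; rewrite (updN _ _ false).
- by move=> i; apply: updE.
right; split; [by rewrite -bE|by rewrite nE1 uphalf_half; lia|by lia].
Qed.

(** The first program wins if both have finished, which keeps the two outcomes
    exclusive. *)
Definition pacc (q : pstate) := halted1 q.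
Definition prej (q : pstate) := ~~ halted1 q && halted2 q.

Lemma pacc_halts t : pacc (pconf t).1 -> exists n, (krun c1 s n).1 = [::].
Proof.
have [n1 [_ [E1 _ _ _ _]]] := pconf_sim t.
by rewrite /pacc /halted1 E1 => /eqP h; exists n1.
Qed.

Lemma prej_halts t : prej (pconf t).1 -> exists n, (krun c2 s n).1 = [::].
Proof.
have [_ [n2 [_ E2 _ _ _]]] := pconf_sim t.
by rewrite /prej /halted2 E2 => /andP[_ /eqP h]; exists n2.
Qed.

(** If a program halts after [n] steps, then its turn has come [n] times after [n.*2]
    steps of the machine, unless the machine has stopped before. *)
Lemma halts_phalted :
  (exists n, (krun c1 s n).1 = [::]) \/ (exists n, (krun c2 s n).1 = [::]) ->
  exists t, pacc (pconf t).1 \/ prej (pconf t).1.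
Proof.
move=> h; suff [t ht] : exists t, phalted (pconf t).1.
  exists t; move: ht; rewrite /phalted /pacc /prej.
  by case: (halted1 _) => /= ?; [left|right].
case: h => -[n hn]; exists n.*2;
  have [n1 [n2 [E1 E2 _ _ []]]] // := pconf_sim n.*2;
  rewrite uphalf_double doubleK => -[_ n1E n2E].
  by rewrite /phalted /halted1 E1 n1E hn eqxx.
by rewrite /phalted /halted2 E2 n2E hn eqxx orbT.
Qed.

Lemma phalted_stuck t t' :
  t <= t' -> phalted (pconf t).1 -> (pconf t').1 = (pconf t).1.
Proof.
move=> /subnK <- h; elim: (t' - t) => // k IH.
by rewrite addSn /mconf iterS -/(mconf _ _ _ _ _) /mstep /= IH h.
Qed.

Lemma pacc_prej t t' : pacc (pconf t).1 -> prej (pconf t').1 -> False.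
Proof.
move=> ha hr; have ht : phalted (pconf t).1 by apply/orP; left.
have ht' : phalted (pconf t').1 by case/andP: hr => _ h; apply/orP; right.
move: ha hr; case: (leqP t t') => tt'.
  by rewrite (phalted_stuck tt' ht) /pacc /prej => ->.
by rewrite (phalted_stuck (ltnW tt') ht') /pacc /prej => ->.
Qed.

End Parallel.

(** * Races between two recursive functions *)
Definition halts n (f : recfun n) v := exists y, eval f v y.

Notation in0 := (@Ordinal 3 0 isT).
Notation in1 := (@Ordinal 3 1 isT).
Notation in2 := (@Ordinal 3 2 isT).

(** The inputs are in the registers 0, 1, 2, the result goes to 3, and the scratch
    registers start at 4. *)
Lemma compile_halts (f : recfun 3) (a b c : nat) :
  (exists n, (krun (compile f [:: 0; 1; 2] 3 4) (nth 0 [:: a; b; c]) n).1 = [::])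
  <-> halts f [:: a; b; c].
Proof.
have spec t := @compile_correct _ f [:: 0; 1; 2] 3 4 (nth 0 [:: a; b; c]) t
  erefl erefl erefl erefl.
have z r : 4 <= r -> nth 0 [:: a; b; c] r = 0 by case: r => [|[|[|[|r]]]].
rewrite halts_exec; split=> [[t /(spec t z)[y hy _]]|[y hy]]; first by exists y.
exists (upd (nth 0 [:: a; b; c]) 3 (nth 0 [:: a; b; c] 3 + y)).
by apply/spec => //; exists y.
Qed.

(** The race over an alphabet of its own.  The numbering [idx] gives the three input
    symbols the numbers 0, 1, 2 whatever [f1] and [f2] are, so that the code of
    an input word does not depend on them. *)
Lemma race_history (f1 f2 : recfun 3) :
  exists (G : finType) (idx : G -> nat) (l : 'I_3 -> G) (h : G) (E : expr G),
  [/\ injective idx, forall i, idx (l i) = i &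
   forall a b c,
   let w := nseq a (l in0) ++ nseq b (l in1) ++ nseq c (l in2) ++ [:: h] in
   halts f1 [:: a; b; c] \/ halts f2 [:: a; b; c] ->
   (halts f1 [:: a; b; c] /\ lee (Mul (word w) (anyw G)) E) \/
   (halts f2 [:: a; b; c] /\ exists u, forall rho, ~ lang rho E (w ++ u))].
Proof.
pose c1 := compile f1 [:: 0; 1; 2] 3 4; pose c2 := compile f2 [:: 0; 1; 2] 3 4.
pose M := pmachine c1 c2.
pose acc (q : pstate c1 c2 * bool) := pacc q.1.
pose rej (q : pstate c1 c2 * bool) := prej q.1.
pose G := sym 'I_3 (pstate c1 c2 * bool)%type (cell (preg c1 c2)).
pose out := queue_out M (@pregs c1 c2).
pose idx (g : G) : nat := if g is inl (Some i) then i else 3 + enum_rank g.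
exists G, idx, (fun i => inl (Some i)), (inl None),
  (histexpr None (pstart c1 c2, false) (queue_next M) acc rej out).
split=> [g g'||a b c w].
- rewrite /idx; case: g => [[i|]|g]; case: g' => [[j|]|g'];
    try (by move=> /eqP; rewrite eqn_add2l => /eqP/val_inj/enum_rank_inj);
    try (by move=> E; have := ltn_ord i; rewrite E);
    try (by move=> E; have := ltn_ord j; rewrite -E).
  by move=> /val_inj->.
- by [].
pose s := nth 0 [:: a; b; c].
pose v := nseq a in0 ++ nseq b in1 ++ nseq c in2.
have sE r : s r = count (fun i : 'I_3 => nat_of_ord i == r) v.
  rewrite !count_cat !count_nseq /s.
  by case: r => [|[|[|r]]] //=; rewrite ?mul1n ?mul0n ?addn0 ?add0n ?nth_nil.
have -> : w = input _ _ v by rewrite /w /input -cats1 !map_cat !map_nseq -!catA.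
rewrite -!compile_halts -/c1 -/c2 -/s => /(halts_phalted sE)[t ht].
have [K [_ [l [_ KE _]] hK]] := queue_sim M (pstart c1 c2) (@pregs c1 c2) v t.
have outp := queue_out_pos M (@pregs c1 c2).
case: ht => ht; [left|right]; split.
- exact: pacc_halts sE _ ht.
- apply: (acc_lee outp (N := K)); first by rewrite KE.
  move=> k /hK[t' t'E]; apply/negP; rewrite /rej t'E; exact: pacc_prej ht.
- exact: prej_halts sE _ ht.
exists (hist None (pstart c1 c2, false) (queue_next M) out v K.+1) => rho.
apply: (rej_notin outp); first by rewrite KE.
move=> k /hK[t' t'E]; apply/negP; rewrite /acc t'E => ha; exact: pacc_prej ha ht.
Qed.

Section Code.
Variables (A : finType) (al be : A).
Hypothesis albe : al != be.

(** The symbol with number [i] becomes the word [be^i al]; these words form a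
    prefix code. *)
Definition letter_code i : expr A := iter i (Mul (Letter be)) (Letter al).
Definition prepend i k (X : expr A) : expr A := iter k (Mul (letter_code i)) X.
(** [T] stands for the end marker of the input followed by arbitrary words, so the
    equation states that all words that begin with the encoded input [(a, b, c)]
    belong to [E]. *)
Definition claim a b c (T E : expr A) : expr A :=
  Add (prepend 0 a (prepend 1 b (prepend 2 c T))) E.

Lemma lang_letter_code rho i : lang rho (letter_code i) = [set nseq i be ++ [:: al]].
Proof.
elim: i => //= i ->; apply/seteqP; split=> [w [_ -> [_ -> <-]]//|_ ->].
by exists [:: be] => //; exists (nseq i be ++ [:: al]).
Qed.

Lemma subst_letter_code s i : subst s (letter_code i) = letter_code i.
Proof. by elim: i => //= i ->. Qed.

Lemma enc_inj (G : finType) (idx : G -> nat) : injective idx ->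
  injective (enc (fun g => nseq (idx g) be ++ [:: al])).
Proof.
move=> idxI; elim=> [|g u IH] [|g' u'] //.
- by rewrite /enc /=; case: (idx g').
- by rewrite /enc /=; case: (idx g).
rewrite /enc /= -!catA /= -/(enc _ u) -/(enc _ u') => E.
suff [/idxI -> /IH ->] : idx g = idx g' /\
  enc (fun g => nseq (idx g) be ++ [:: al]) u =
  enc (fun g => nseq (idx g) be ++ [:: al]) u'.
  by [].
elim: (idx g) (idx g') E => [|n IHn] [|m] //=.
- by case.
- by case=> E; move: albe; rewrite E eqxx.
- by case=> E; move: albe; rewrite E eqxx.
by case=> /IHn[-> ->].
Qed.

Lemma iter_word (G : finType) k (g : G) X :
  eqv (iter k (Mul (Letter g)) X) (Mul (word (nseq k g)) X).
Proof.
elim: k => [|k IH] /=; first by rewrite eqv_1mul.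
by rewrite IH eqv_mulA.
Qed.

Lemma lang_iter_word (G : finType) rho k (g : G) X w :
  lang rho X w -> lang rho (iter k (Mul (Letter g)) X) (nseq k g ++ w).
Proof.
move=> hw; elim: k => // k IH; rewrite iterS; apply/lang_Mul.
by exists [:: g], (nseq k g ++ w).
Qed.

(** The race transferred to two letters of the given alphabet.  That [T] and [E] do
    not depend on [a], [b] and [c] is what permits the self-reference below. *)
Theorem race_claim (f1 f2 : recfun 3) : exists T E : expr A, forall a b c,
  halts f1 [:: a; b; c] \/ halts f2 [:: a; b; c] ->
  (halts f1 [:: a; b; c] /\ eqv (claim a b c T E) E) \/
  (halts f2 [:: a; b; c] /\ ~ valid (claim a b c T E, E)).
Proof.
have [G [idx [l [h [E [idxI lE H]]]]]] := race_history f1 f2.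
pose cd g := letter_code (idx g).
pose T := Mul (Letter h) (anyw G).
exists (hom cd T), (hom cd E) => a b c hl.
pose X := iter a (Mul (Letter (l in0))) (iter b (Mul (Letter (l in1)))
  (iter c (Mul (Letter (l in2))) T)).
have homI k g Y : hom cd (iter k (Mul (Letter g)) Y) = prepend (idx g) k (hom cd Y).
  by elim: k => //= k ->.
have claimE : claim a b c (hom cd T) (hom cd E) = hom cd (Add X E).
  by rewrite /claim /= !homI !lE.
have cdS s g : subst s (cd g) = cd g by apply: subst_letter_code.
rewrite claimE; case: (H a b c hl) => -[hf hE]; [left|right]; split=> //.
  apply: (hom_eqv cdS (f := E)); rewrite -[X in eqv _ X]hE.
  apply: d_add; last exact: eqv_refl.
  rewrite /X !iter_word /T !word_cat -!eqv_mulA /=.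
  by rewrite eqv_1mul; apply: eqv_refl.
case: hE => u hu val; apply: (hu (fun=> set0)).
pose code (g : G) := nseq (idx g) be ++ [:: al].
have cdL rho g : lang rho (cd g) = [set code g] by apply: lang_letter_code.
pose rho (i : nat) : set (seq G) := set0.
have eqL : lang (fun i => enc code @` rho i) (hom cd (Add X E)) =
           lang (fun i => enc code @` rho i) (hom cd E) := val _.
rewrite !(lang_hom cdL) in eqL.
set w := (X in lang _ _ X).
have : (enc code @` lang rho E) (enc code w).
  rewrite -eqL; exists w => //; apply/lang_Add; left; rewrite /w -!catA.
  do 3!apply: lang_iter_word.
  by apply/lang_Mul; exists [:: h], u; split=> //; apply: lang_any.
by case=> w' hw' /(enc_inj idxI) <-.
Qed.

End Code.

(** * Computing the code of an equation *)
Section Computable.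

Definition computable n (F : seq nat -> nat) :=
  exists f : recfun n, forall v, size v = n -> forall y, eval f v y <-> y = F v.

Lemma computable_ext n F F' : (forall v, size v = n -> F v = F' v) ->
  computable n F -> computable n F'.
Proof. by move=> FF [f fP]; exists f => v sv y; rewrite fP // FF. Qed.

Lemma computable_proj n i : i < n -> computable n (fun v => nth 0 v i).
Proof. by move=> lt; exists (RProj (Ordinal lt)). Qed.

Lemma computable_succ : computable 1 (fun v => (head 0 v).+1).
Proof. by exists RSucc. Qed.

Lemma computable_comp m n F (G : nat -> seq nat -> nat) :
  computable m F -> (forall i, i < m -> computable n (G i)) ->
  computable n (fun v => F (mkseq (G^~ v) m)).
Proof.
move=> [f fP] GP; have [g gP] := choice (fun i : 'I_m => GP i (ltn_ord i)).
exists (RComp f g) => v sv y; split=> [[w [sw gw]]|->].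
  suff <- : w = mkseq (G^~ v) m by move/(fP _ sw).
  apply: (@eq_from_nth _ 0); rewrite ?size_mkseq sw // => i im.
  by rewrite nth_mkseq //; apply/(gP (Ordinal im)) => //; apply: (gw (Ordinal im)).
exists (mkseq (G^~ v) m); split; first exact: size_mkseq.
  by move=> i; apply/gP => //; rewrite nth_mkseq ?ltn_ord.
by apply/fP => //; exact: size_mkseq.
Qed.

Lemma computable_comp1 n F G :
  computable 1 F -> computable n G -> computable n (fun v => F [:: G v]).
Proof. by move=> hF hG; apply: (computable_comp (G := fun=> G) hF). Qed.

Lemma computable_comp2 n F G1 G2 : computable 2 F ->
  computable n G1 -> computable n G2 -> computable n (fun v => F [:: G1 v; G2 v]).
Proof.
move=> hF h1 h2.
by apply: (computable_comp (G := fun i => if i is 0 then G1 else G2) hF) => -[].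
Qed.

Lemma computable_comp3 n F G1 G2 G3 : computable 3 F ->
  computable n G1 -> computable n G2 -> computable n G3 ->
  computable n (fun v => F [:: G1 v; G2 v; G3 v]).
Proof.
move=> hF h1 h2 h3.
by apply: (computable_comp (G := fun i =>
  if i is i'.+1 then if i' is 0 then G2 else G3 else G1) hF) => -[|[]].
Qed.

Lemma computable_const n k : computable n (fun=> k).
Proof.
elim: k => [|k IH]; last exact: computable_comp1 computable_succ IH.
apply: (@computable_comp 0 n (fun=> 0) (fun=> (fun=> 0))) => //.
by exists RZero.
Qed.

Lemma computable_rec n F G (h : nat -> seq nat -> nat) :
  computable n F -> computable n.+2 G ->
  (forall v, h 0 v = F v) -> (forall k v, h k.+1 v = G [:: k, h k v & v]) ->
  computable n.+1 (fun v => h (head 0 v) (behead v)).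
Proof.
move=> [f fP] [g gP] h0 hS; exists (RRec f g) => -[//|k v] [sv] y.
change (rec_graph (eval f) (eval g) v k y <-> y = h k v).
elim: k y => [|k IH] y; first by rewrite h0; apply: fP.
have gE z : eval g [:: k, h k v & v] z <-> z = h k.+1 v.
  by rewrite hS; apply: gP; rewrite /= sv.
split=> [[z /IH -> /gE]|/gE yE] //; exists (h k v) => //; exact/IH.
Qed.

Lemma computable_add : computable 2 (fun v => nth 0 v 0 + nth 0 v 1).
Proof.
apply: (@computable_ext _ (fun v => (fun k w => k + head 0 w) (head 0 v) (behead v))).
  by case=> [|x [|y []]].
apply: (@computable_rec 1 (fun v => nth 0 v 0) (fun v => (nth 0 v 1).+1)
  (fun k w => k + head 0 w)) => //.
- exact: computable_proj.
- by apply: (computable_comp1 (F := fun v => (head 0 v).+1) computable_succ);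
    apply: computable_proj.
Qed.

Definition tri k := (k * k.+1)./2.

Lemma triS k : tri k.+1 = tri k + k.+1.
Proof.
rewrite /tri (_ : k.+1 * k.+2 = k * k.+1 + k.+1.*2); last by rewrite -muln2; nia.
by rewrite halfD odd_double andbF add0n doubleK.
Qed.

Lemma computable_tri : computable 1 (fun v => tri (head 0 v)).
Proof.
apply: (@computable_rec 0 (fun=> 0) (fun v => nth 0 v 1 + (nth 0 v 0).+1)
  (fun k _ => tri k)) => //.
- exact: computable_const.
- apply: (computable_comp2 (F := fun v => nth 0 v 0 + nth 0 v 1)
    (G1 := fun v => nth 0 v 1) (G2 := fun v => (nth 0 v 0).+1)).
  + exact: computable_add.
  + exact: computable_proj.
  by apply: (computable_comp1 (F := fun v => (head 0 v).+1) computable_succ);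
    apply: computable_proj.
by move=> k v; rewrite triS.
Qed.

Lemma computable_cpair n F G : computable n F -> computable n G ->
  computable n (fun v => cpair (F v) (G v)).
Proof.
move=> hF hG.
have hs : computable n (fun v => F v + G v).
  by apply: (computable_comp2 (F := fun v => nth 0 v 0 + nth 0 v 1)) => //;
    apply: computable_add.
apply: (computable_comp2 (F := fun v => nth 0 v 0 + nth 0 v 1)
    (G1 := fun v => tri (F v + G v)) (G2 := G)) => //.
  exact: computable_add.
by apply: (computable_comp1 (F := fun v => tri (head 0 v)) (G := fun v => F v + G v)) => //;
  apply: computable_tri.
Qed.

(** The code of an expression with a fixed factor prepended a variable number of
    times. *)
Lemma computable_iter n w F G : computable n F -> computable n G ->
  computable n (fun v => iter (F v) (fun z => cpair 5 (cpair w z)) (G v)).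
Proof.
move=> hF hG.
apply: (computable_comp2
  (F := fun v => (fun k u => iter k (fun z => cpair 5 (cpair w z)) (nth 0 u 0))
                   (head 0 v) (behead v))) => //.
apply: (@computable_rec 1 (fun v => nth 0 v 0)
  (fun v => cpair 5 (cpair w (nth 0 v 1)))
  (fun k u => iter k (fun z => cpair 5 (cpair w z)) (nth 0 u 0))) => //.
  exact: computable_proj.
do 2!(apply: computable_cpair; first exact: computable_const).
exact: computable_proj.
Qed.

End Computable.

(** [n] is smaller than the gap between consecutive triangular numbers, so the sum
    [m + n] can be recovered. *)
Lemma cpair_inj m n m' n' : cpair m n = cpair m' n' -> m = m' /\ n = n'.
Proof.
rewrite /cpair -!/(tri _) => E.
have mono i j : i < j -> tri i + i < tri j.
  elim: j => // j IH; rewrite ltnS leq_eqVlt triS => /orP[/eqP->|/IH]; lia.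
have sE : m + n = m' + n'.
  by case: (ltngtP (m + n) (m' + n')) => // /mono; lia.
by move: E; rewrite sE => /addnI nE; lia.
Qed.

Lemma code_inj (A : finType) : injective (@code A).
Proof.
elim=> [||a|i|e IHe f IHf|e IHe f IHf|e IHe] [||b|j|e' f'|e' f'|e'] //=
  /cpair_inj[] //.
- by move=> _ /val_inj/enum_rank_inj->.
- by move=> _ ->.
- by move=> _ /cpair_inj[/IHe-> /IHf->].
- by move=> _ /cpair_inj[/IHe-> /IHf->].
by move=> _ /IHe->.
Qed.

Lemma code_eqn_inj (A : finType) : injective (@code_eqn A).
Proof. by case=> e f [e' f'] /cpair_inj[/code_inj/= -> /code_inj/= ->]. Qed.

Lemma computable_comp_halts n (f : recfun 1) F : computable n F ->
  exists g : recfun n, forall v, size v = n -> (halts g v <-> halts f [:: F v]).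
Proof.
case=> g gP; exists (RComp f (fun=> g)) => v sv; split.
  case=> y [[|x [|x' u]] [] // _ /(_ ord0)/(gP _ sv) /= <- fx]; by exists y.
case=> y fy; exists y, [:: F v]; split=> // i.
by apply/gP => //; rewrite ord1.
Qed.

Theorem theorem24 (A : finType) (hA : 1 < #|A|) (U : set (equation A))
    (U_re : recursively_enumerable (coded U))
    (U_ext : forall e f : expr A, derivable (@muS_idem_axiom A) e f -> U (e, f))
    (U_sound : forall e f : expr A, U (e, f) -> valid (e, f)) :
  Sigma01_complete (coded U).
Proof.
split=> // P [fP fPP]; have [fU fUP] := U_re.
have /card_gt1P[al [be [_ _ albe]]] := hA.
pose w i := code (letter_code al be i).
pose it i k z := iter k (fun z => cpair 5 (cpair (w i) z)) z.
(* The code of the claim as a function of n and of the codes of T and E. *)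
pose H (v : seq nat) :=
  let n := nth 0 v 0 in let x := nth 0 v 1 in let y := nth 0 v 2 in
  cpair (cpair 4 (cpair (it 0 n (it 1 x (it 2 y x))) y)) y.
have Hcomp : computable 3 H.
  have p i : i < 3 -> computable 3 (fun v => nth 0 v i) by apply: computable_proj.
  apply: computable_cpair; last exact: p.
  apply: computable_cpair; first exact: computable_const.
  apply: computable_cpair; last exact: p.
  by do 3?[apply: computable_iter; first exact: p]; apply: p.
have [f1 f1P] := computable_comp_halts fP (computable_proj (isT : 0 < 3)).
have [f2 f2P] := computable_comp_halts fU Hcomp.
have [T [E race]] := race_claim albe f1 f2.
pose eqn n := (claim al be n (code T) (code E) T E, E).
pose h n := H [:: n; code T; code E].
have hE n : h n = code_eqn (eqn n).
  rewrite /h /H /code_eqn /=; congr (cpair (cpair _ (cpair _ _)) _).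
  have numE i k X : code (prepend al be i k X) = it i k (code X).
    by elim: k => //= k ->.
  by rewrite !numE.
have Uh n : coded U (h n) <-> U (eqn n).
  rewrite hE; split=> [[q Uq /code_eqn_inj <-]//|Uq]; by exists (eqn n).
exists h.
  have [g gP] : computable 1 (fun v => H [:: nth 0 v 0; code T; code E]).
    apply: computable_comp3 Hcomp _ _ _; first exact: computable_proj.
      exact: computable_const.
    exact: computable_const.
  by exists g => n; apply/gP.
move=> n; set v := [:: n; code T; code E].
have hP : P n <-> halts f1 v by rewrite f1P // fPP.
have hU : U (eqn n) <-> halts f2 v by rewrite f2P // -Uh fUP.
rewrite Uh; split=> [/hP h1|/[dup] Un /hU h2].
  case: (race n (code T) (code E) (or_introl h1)) => -[h12]; first exact: U_ext.
  by move/hU: h12.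
case: (race n (code T) (code E) (or_intror h2)) => -[]; first by move/hP.
by move=> _ nval; case: nval; apply: U_sound.
Qed.
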